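(* Let $d\geq 3$ be an integer. Then $$p_c^{\mathcal S} \geq \frac{1}{8(d-1)} .$$ Moreover, for every $p\in(0,1)$ with $p<\frac{1}{8(d-1)}$ and every $\alpha\in\bigl(\sqrt{8p(d-1)},\,1\bigr)$, there exist a constant $C>0$ and a random sphere $S$ (a function of the percolation configuration, defined $\mathbb{P}_p$-almost surely) such that, $\mathbb{P}_p$-almost surely, $S$ intersects only closed bonds and has the origin in its inside, and $$\mathbb{P}_p\bigl(\operatorname{rad}[S]\geq r\bigr)\leq C\alpha^r \qquad \text{for all } r>0 .$$
   Context: Bond percolation on $\mathbb{Z}^d$: vertices are the elements of $\mathbb{Z}^d$, and edges are pairs of vertices at Euclidean distance one. For $p\in(0,1)$, under the probability measure $\mathbb{P}_p$ each edge is open with probability $p$ and closed with probability $1-p$, independently of the other edges. The bond of an edge is the closed straight segment in $\mathbb{R}^d$ joining its two endpoints; a bond is open or closed according to the state of its edge. A sphere is a subset of $\mathbb{R}^d$ that is (the underlying set of) a finite simplicial complex and is homeomorphic to the Euclidean unit sphere $S^{d-1}=\{x\in\mathbb{R}^d : x_1^2+\dots+x_d^2=1\}$. All spheres considered are disjoint from $\mathbb{Z}^d$. The inside of a sphere is the unique bounded connected component of its complement in $\mathbb{R}^d$. A sphere intersects only closed bonds if every bond having a nonempty intersection with it is closed. $\mathcal{S}$ denotes the event that there exists a sphere intersecting only closed bonds and having the origin in its inside, and $$p_c^{\mathcal S} := \inf\{p\in[0,1] : \mathbb{P}_p(\mathcal{S})=0\}.$$ The radius of a set $A\subset\mathbb{R}^d$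 is $\operatorname{rad}[A]=\sup\bigl\{\sum_{i=1}^d|x_i| : (x_1,\dots,x_d)\in A\bigr\}$. *)

(* Defs.v *)
From HB Require Import structures.
From mathcomp Require Import all_boot all_order all_algebra finmap.
From mathcomp Require Import ring lra.
From mathcomp Require Import all_classical all_reals all_analysis.
From mathcomp Require Import measurable_realfun.

Set Implicit Arguments.
Unset Strict Implicit.
Unset Printing Implicit Defensive.

Import Order.TTheory GRing.Theory Num.Theory.
Import numFieldNormedType.Exports.

Local Open Scope classical_set_scope.
Local Open Scope ring_scope.

Section Lattice.
Variable d : nat.

Definition vertex := 'rV[int]_d.

(* The squared Euclidean distance is an integer, so it is compared to 1 in int. *)
Definition neighbours (x y : vertex) : bool :=
  \sum_(i < d) (x ord0 i - y ord0 i) ^+ 2 == 1.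

Definition is_edge (e : {fset vertex}) : bool :=
  `[< exists x y : vertex, neighbours x y /\ e = [fset x; y]%fset >].

Definition edge := {e : {fset vertex} | is_edge e}.
HB.instance Definition _ := Countable.on edge.

(* A configuration maps an edge to true when the edge is open; the sigma-algebra
   is the product one, generated by the events "e is open". *)
Definition open_events : set (set (edge -> bool)) :=
  [set A | exists e : edge, A = [set w : edge -> bool | w e]].

Definition config := g_sigma_algebraType open_events.

End Lattice.

Section Percolation.
Variables (R : realType) (d : nat).

Definition is_percolation (p : R) (P : probability (config d) R) : Prop :=
  forall (F : {fset edge d}) (s : edge d -> bool),
    P [set w : config d | forall e, e \in F -> w e = s e] =
    (\prod_(e <- F) (if s e then p else 1 - p))%:E.

(* The product formula characterizes this probability; its existence for
   0 <= p <= 1 is percolationP below. *)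
Definition percolation (p : R) : probability (config d) R :=
  get [set P | is_percolation p P].

End Percolation.

(* Existence: for x uniform on [0, 1[, the digits of x in the expansion driven by
   the interval map shift are independent Bernoulli(p); the state of an edge is
   the digit whose index is the code of the edge. *)
Section Existence.
Variables (R : realType) (p : R).
Hypothesis p01 : 0 <= p <= 1.

Let shift (x : R) : R := if x < p then x / p else (x - p) / (1 - p).
Let digit (n : nat) (x : R) : bool := iter n shift x < p.
Let weight (o : option bool) : R :=
  if o is Some b then if b then p else 1 - p else 1.
Let agrees (o : option bool) (b : bool) : bool :=
  if o is Some b' then b == b' else true.
Fixpoint follows (l : seq (option bool)) (x : R) : bool :=
  if l is o :: l' then agrees o (x < p) && follows l' (shift x) else true.
Fixpoint left_end (s : seq bool) : R :=
  if s is b :: s' then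
    if b then p * left_end s' else p + (1 - p) * left_end s'
  else 0.
Let mass (l : seq (option bool)) : R := \prod_(o <- l) weight o.
Let mu : probability _ R := uniform_prob (@ltr01 R).

Let mass_word_ge0 s : 0 <= mass (map some s).
Proof.
rewrite /mass big_map; apply: prodr_ge0 => b _ /=.
by case: b; case/andP: p01 => ? ?; lra.
Qed.

Let left_end_bounds s : 0 <= left_end s /\ left_end s + mass (map some s) <= 1.
Proof.
case/andP: p01 => p0 p1.
elim: s => [|b s [l0 l1]] /=; first by rewrite /mass big_nil; split; lra.
have m0 := mass_word_ge0 s; rewrite /mass big_cons -/(mass _) /=.
by case: b; split; nra.
Qed.

Let follows_itv s x : 0 <= x < 1 ->
  follows (map some s) x = (left_end s <= x < left_end s + mass (map some s)).
Proof.
case/andP: p01 => p0 p1.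
elim: s x => [|b s IH] x /andP[x0 x1] /=.
  by rewrite /mass big_nil add0r x0 x1.
have m0 := mass_word_ge0 s; have [l0 l1] := left_end_bounds s.
rewrite /mass big_cons -/(mass _) /= /shift.
have [xp|px] := ltP x p.
  have pp : 0 < p by lra.
  case: b => /=.
    rewrite IH; last by rewrite divr_ge0//= ltr_pdivrMr// mul1r.
    rewrite ler_pdivlMr// ltr_pdivrMr//.
    by apply/idP/idP => /andP[? ?]; apply/andP; split; nra.
  by apply/esym/negbTE/negP => /andP[h _]; nra.
have pp : 0 < 1 - p by lra.
case: b => /=.
  by apply/esym/negbTE/negP => /andP[_ h]; nra.
rewrite IH; last by rewrite divr_ge0 ?subr_ge0//= ltr_pdivrMr// mul1r; lra.
rewrite ler_pdivlMr// ltr_pdivrMr//.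
by apply/idP/idP => /andP[? ?]; apply/andP; split; nra.
Qed.

Let measurable_shift : measurable_fun [set: R] shift.
Proof.
apply: measurable_fun_if => //; first exact: measurable_fun_ltr.
- by apply: measurable_funTS; apply: measurable_funM.
- by apply: measurable_funTS; apply: measurable_funM => //; apply: measurable_funB.
Qed.

Let measurable_iter n : measurable_fun [set: R] (iter n shift).
Proof.
elim: n => [|n IH]; first exact: measurable_id.
exact: (measurableT_comp measurable_shift IH).
Qed.

Let measurable_digit n : measurable_fun [set: R] (digit n).
Proof. exact: measurable_fun_ltr. Qed.

Let measurable_follows l : measurable [set x : R | follows l x].
Proof.
elim: l => [|o l IH] /=; first by rewrite [X in measurable X](_ : _ = setT) //; apply/seteqP.
rewrite [X in measurable X](_ : _ =
  [set x | agrees o (digit 0 x)] `&` (shift @^-1` [set x | follows l x])).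
  apply: measurableI; last by rewrite -[X in measurable X]setTI; exact: measurable_shift.
  rewrite -[X in measurable X]setTI.
  exact: (measurable_digit 0 measurableT (Y := [set b | agrees o b])).
by apply/seteqP; split=> x /= => [/andP[]|[-> ->]].
Qed.

Let mu_itv (a b : R) : 0 <= a -> a <= b -> b <= 1 -> mu `[a, b[%classic = (b - a)%:E.
Proof.
move=> a0 ab b1; rewrite /mu /= /uniform_prob.
rewrite integral_uniform_pdf setIidl; last first.
  move=> x /=; rewrite !in_itv/= => /andP[? ?]; lra.
rewrite (eq_integral (fun=> 1%:E)); last first.
  move=> x; rewrite inE/= in_itv/= /uniform_pdf subr0 invr1 => /andP[? ?].
  by rewrite ifT//; lra.
rewrite integral_cst//= mul1e lebesgue_measure_itv/= lte_fin.
by move: ab; rewrite le_eqVlt => /predU1P[->|->]; rewrite ?ltxx ?subrr ?EFinN.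
Qed.

Let mu01 A : measurable A -> mu A = mu (A `&` `[0, 1[%classic).
Proof.
move=> mA; have mI : measurable (`[0, 1[%classic : set R) by exact: measurable_itv.
rewrite (measureDI mu mA mI) [X in (X + _)%E = _](_ : _ = 0%E) ?add0e//.
apply: subset_measure0 (_ : mu (~` `[0, 1[%classic) = 0%E).
- exact: measurableD.
- exact: measurableC.
- by move=> x [].
- by rewrite probability_setC// mu_itv// subr0 subee.
Qed.

Let mu_word s : mu [set x | follows (map some s) x] = (mass (map some s))%:E.
Proof.
have [l0 l1] := left_end_bounds s; have m0 := mass_word_ge0 s.
rewrite mu01; last exact: measurable_follows.
rewrite (_ : _ `&` _ =
  `[left_end s, left_end s + mass (map some s)[%classic).
  by rewrite mu_itv//; [congr EFin; ring | rewrite lerDl].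
apply/seteqP; split=> x /=; rewrite !in_itv/=.
  by move=> [+ x01]; rewrite follows_itv.
move=> xI; have x01 : 0 <= x < 1 by case/andP: xI => ? ?; lra.
by rewrite follows_itv.
Qed.

Let follows_cat l m x :
  follows (l ++ m) x = follows l x && follows m (iter (size l) shift x).
Proof.
elim: l x => //= o l IH x.
by rewrite IH -andbA -iterSr.
Qed.

Let mu_follows c s :
  mu [set x | follows (map some s ++ c) x] = (mass (map some s) * mass c)%:E.
Proof.
elim: c s => [|[b|] c IH] s.
- by rewrite cats0 mu_word [X in _ * X]/mass big_nil mulr1.
- rewrite -cat_rcons -map_rcons IH; congr EFin.
  by rewrite map_rcons /mass -cats1 big_cat big_seq1 big_cons /= mulrA.
rewrite (_ : [set x | _] =
    [set x | follows (map some (rcons s true) ++ c) x] `|`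
    [set x | follows (map some (rcons s false) ++ c) x]).
  transitivity (mu [set x | follows (map some (rcons s true) ++ c) x] +
      mu [set x | follows (map some (rcons s false) ++ c) x])%E.
    apply: measureU; [exact: measurable_follows..|].
    apply/seteqP; split=> x //= []; rewrite !map_rcons !cat_rcons !follows_cat /=.
    by case: (_ < p); rewrite ?andbF.
  rewrite !IH -EFinD; congr EFin.
  by rewrite !map_rcons /mass -!cats1 !big_cat !big_seq1 big_cons /=; ring.
apply/seteqP; split=> x /=; rewrite !map_rcons !cat_rcons !follows_cat /=.
  by case: (_ < p) => ->; [left|right].
by case: (_ < p) => -[] /andP[-> //=].
Qed.

Let followsP l x :
  (forall i, (i < size l)%N -> agrees (nth None l i) (digit i x)) <-> follows l x.
Proof.
elim: l x => [|o l IH] x //=; split.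
  move=> h; apply/andP; split; first exact: (h 0%N).
  by apply/IH => i il; move: (h i.+1 il); rewrite /digit iterSr.
move=> /andP[h0 /IH h] [|i] // il.
by rewrite /digit iterSr; exact: h.
Qed.

Lemma percolation_exists d : exists P, @is_percolation R d p P.
Proof.
pose X (x : measurableTypeR R) : config d := fun e => digit (choice.pickle e) x.
have mX : measurable_fun setT X.
  have H := (@measurability _ _ _ _ setT X (open_events (d := d)) erefl).
  apply: H => // _ [_ [e ->] <-].
  rewrite setTI; rewrite -[X in measurable X]setTI.
  exact: (measurable_digit (choice.pickle e) measurableT (Y := [set true])).
exists (distribution mu (mfun_Sub (mem_set mX))) => F s.
pose c i := if @choice.pickle_inv (edge d) i is Some e then
              if e \in F then Some (s e) else None else None.
have cE e : c (choice.pickle e) = if e \in F then Some (s e) else None.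
  by rewrite /c choice.pickleK_inv.
pose N := (\max_(e <- F) (choice.pickle e).+1)%N.
have ltN e : e \in F -> (choice.pickle e < N)%N.
  by move=> eF; rewrite /N (big_fsetD1 e)//= leq_max leqnn.
transitivity (mu [set x | follows (map some [::] ++ mkseq c N) x]).
  congr (mu _); apply/seteqP; split=> x /=.
    move=> h; apply/followsP => i; rewrite size_mkseq => iN; rewrite nth_mkseq//.
    rewrite /c; case E : (choice.pickle_inv i) => [e|] //; case: ifPn => // eF.
    have <- : choice.pickle e = i by have := @choice.pickle_invK (edge d) i; rewrite E.
    by rewrite /= -[digit _ _]/(X x e) h.
  move/followsP => h e eF; have := h (choice.pickle e).
  by rewrite size_mkseq => /(_ (ltN _ eF)); rewrite nth_mkseq ?ltN// cE eF => /eqP.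
rewrite mu_follows {1}/mass big_nil mul1r; congr EFin.
rewrite /mass big_map (bigID (fun i => c i == None)) /= big1 ?mul1r; last first.
  by move=> i /eqP ->.
rewrite -big_filter (perm_big [seq choice.pickle e | e <- F]) /=.
  by rewrite big_map big_seq [RHS]big_seq; apply: eq_bigr => e eF; rewrite cE eF.
apply: uniq_perm.
- by rewrite filter_uniq// iota_uniq.
- by rewrite map_inj_uniq ?fset_uniq//; exact: pcan_inj (@choice.pickleK _).
move=> i; rewrite mem_filter mem_iota /= add0n; apply/idP/idP.
  rewrite /c; case E : (choice.pickle_inv i) => [e|] //; case: ifPn => // eF _.
  have <- : choice.pickle e = i by have := @choice.pickle_invK (edge d) i; rewrite E.
  exact: map_f.
by move=> /mapP[e eF ->]; rewrite cE eF ltN.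
Qed.

End Existence.

Lemma percolationP (R : realType) (d : nat) (p : R) :
  0 <= p <= 1 -> is_percolation p (percolation d p).
Proof.
move=> p01; have [P hP] := percolation_exists p01 d.
exact: (@getPex _ [set Q | is_percolation p Q] (ex_intro _ P hP)).
Qed.

Section Spheres.
Variables (R : realType) (d : nat).
Local Notation space := 'rV[R]_d.

Definition lattice_point (x : vertex d) : space := map_mx intr x.

Definition bond (e : edge d) : set space :=
  [set z | exists (x y : vertex d) (t : R),
     [/\ val e = [fset x; y]%fset, 0 <= t <= 1 &
         z = (1 - t) *: lattice_point x + t *: lattice_point y]].

Definition hull (V : {fset space}) : set space :=
  [set z | exists w : space -> R,
     [/\ forall v, v \in V -> 0 <= w v, \sum_(v <- V) w v = 1 &
         z = \sum_(v <- V) w v *: v]].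

Definition affinely_independent (V : {fset space}) : Prop :=
  forall w : space -> R, \sum_(v <- V) w v = 0 -> \sum_(v <- V) w v *: v = 0 ->
  forall v, v \in V -> w v = 0.

Definition is_face (F : set space) (V : {fset space}) : Prop :=
  exists W : {fset space}, [/\ W != fset0, (W `<=` V)%fset & F = hull W].

(* A simplex is represented by the set of its vertices. *)
Definition simplicial_complex (K : {fset {fset space}}) : Prop :=
  [/\ forall V, V \in K -> V != fset0 /\ affinely_independent V,
      forall V W, V \in K -> W != fset0 -> (W `<=` V)%fset -> W \in K &
      forall V W, V \in K -> W \in K -> hull V `&` hull W !=set0 ->
        is_face (hull V `&` hull W) V /\ is_face (hull V `&` hull W) W].

Definition underlying_set (K : {fset {fset space}}) : set space :=
  \bigcup_(V in [set` K]) hull V.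

Definition homeomorphic (A B : set space) : Prop :=
  exists f g : space -> space,
    [/\ {within A, continuous f}, {within B, continuous g},
        set_fun A B f /\ set_fun B A g,
        {in A, cancel f g} & {in B, cancel g f}].

Definition unit_sphere : set space := [set x | \sum_(i < d) x ord0 i ^+ 2 = 1].

Definition sphere (A : set space) : Prop :=
  [/\ exists K, simplicial_complex K /\ A = underlying_set K,
      homeomorphic A unit_sphere &
      A `&` range lattice_point = set0].

(* The union of all bounded components of the complement; for a sphere there is
   exactly one such component. *)
Definition inside (A : set space) : set space :=
  \bigcup_(U in [set connected_component (~` A) x | x in ~` A] `&` bounded_set) U.

Definition meets_only_closed_bonds (w : config d) (A : set space) : Prop :=
  forall e : edge d, bond e `&` A !=set0 -> w e = false.

Definition closed_sphere_around_origin (w : config d) (A : set space) : Prop :=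
  [/\ sphere A, meets_only_closed_bonds w A & inside A 0].

Definition sphere_event : set (config d) :=
  [set w | exists A, closed_sphere_around_origin w A].

Definition l1_radius (A : set space) : \bar R :=
  ereal_sup [set (\sum_(i < d) `|x ord0 i|)%:E | x in A].

Definition p_c_sphere : R :=
  inf [set p : R | 0 <= p <= 1 /\ percolation d p sphere_event = 0%E].

End Spheres.

(* Main.v *)
Require Import Defs.
From mathcomp Require Import all_boot all_order all_algebra finmap.
From mathcomp Require Import ring lra zify.
From mathcomp Require Import all_classical all_reals all_analysis.
From mathcomp Require Import measurable_realfun.

Set Implicit Arguments.
Unset Strict Implicit.
Unset Printing Implicit Defensive.

Import Order.TTheory GRing.Theory Num.Theory.
Import numFieldNormedType.Exports.

Local Open Scope classical_set_scope.
Local Open Scope ring_scope.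

(** From a vertex one may always step to its parent (its last nonzero coordinate
    moved one step towards 0) and may also cross any open edge. Let A be the set
    of vertices reachable from the origin. No open edge leaves A. A parent step
    lowers |x|_1 by 1 and any other step raises it by at most 1, so a walk from
    the origin has at most as many parent steps as other steps. Give weight s to a
    parent step and p/s to any other step, with s^2 = 2p(d-1): the steps out of a
    vertex, other than backtracking, have total weight at most
    s + 2(d-1)p/s = sqrt(8p(d-1)). Counting self-avoiding walks, A is almost surely
    finite and its radius has an exponential tail.

    Let f be the interpolation of the indicator of A, affine on each simplex of
    the Freudenthal-Kuhn triangulation, minus a small multiple of |.|_1. As A is
    stable under parents, f(z_1, .., z_k, 0, .., 0) is strictly decreasing in
    |z_k| for every k. So the squares in
      (sgn z_k sqrt(f(z_1, .., z_{k-1}, 0, ..) - f(z_1, .., z_k, 0, ..)))_k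
    telescope to 1 - f(z), and these coordinates define a homeomorphism of R^d
    taking {f = 1/2} to a round sphere. Since bonds are edges of the
    triangulation, {f = 1/2} meets only bonds between A and its complement. It
    cuts each simplex in a product of two simplices, which the staircase
    triangulation subdivides: simplices are chains of pairs (a, b) with a in A and
    b outside A, and uniqueness of barycentric coordinates is uniqueness of a
    monotone coupling with given marginals. *)

(** * The Freudenthal-Kuhn triangulation *)

Section Kuhn.
Variables (R : realType) (d : nat).
Local Notation space := 'rV[R]_d.
Implicit Types (u z : space) (v : vertex d) (F : {fset vertex d}).

Local Notation lp := (lattice_point R).

Definition peak u : R := \big[Num.max/0]_i u ord0 i.

(* The hat functions of the Freudenthal-Kuhn triangulation: [hat v] is 1 at [v],
   vanishes at the other lattice points and is affine on each simplex. *)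
Definition hat v z : R := Num.max 0 (1 - peak (z - lp v) - peak (lp v - z)).

(* For t uniform in [0, 1[, the floor of [z + t] is [v] with probability [hat v z]. *)
Definition floor_cell v z : set R :=
  [set t | 0 <= t < 1 /\ forall i, (v ord0 i)%:~R <= z ord0 i + t < (v ord0 i)%:~R + 1].

Lemma peak_ge0 u : 0 <= peak u.
Proof. exact: bigmax_ge_id. Qed.

Lemma le_peak u i : u ord0 i <= peak u.
Proof. exact: le_bigmax. Qed.

Lemma peak_leP u (m : R) : 0 <= m -> (forall i, u ord0 i <= m) -> peak u <= m.
Proof. by move=> m0 h; apply: bigmax_le => // i _; apply: h. Qed.

Lemma peak_ltP u (m : R) : 0 < m -> (forall i, u ord0 i < m) -> peak u < m.
Proof. by move=> m0 h; apply: bigmax_lt => // i _; apply: h. Qed.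

Lemma hat_ge0 v z : 0 <= hat v z.
Proof. by rewrite /hat le_max lexx. Qed.

(** The constraints bounding [t] from below combine into one maximum and those bounding it from
    above into another; the 0 inside [peak] accounts for [0 <= t < 1]. *)
Lemma floor_cellE v z :
  floor_cell v z = `[peak (lp v - z), 1 - peak (z - lp v)[%classic.
Proof.
apply/seteqP; split => t /=; rewrite in_itv /=.
  move=> [/andP[t0 t1] h]; apply/andP; split.
    by apply: peak_leP => // i; have /andP[+ _] := h i; rewrite !mxE; lra.
  suff : peak (z - lp v) < 1 - t by lra.
  apply: peak_ltP; first by lra.
  by move=> i; have /andP[_ +] := h i; rewrite !mxE; lra.
move=> /andP[h1 h2].
have := peak_ge0 (lp v - z); have := peak_ge0 (z - lp v) => p1 p2.
split; first lra.
move=> i; have := le_peak (lp v - z) i; have := le_peak (z - lp v) i.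
by rewrite !mxE; lra.
Qed.

Lemma floor_cell_measure v z : lebesgue_measure (floor_cell v z) = (hat v z)%:E.
Proof.
rewrite floor_cellE lebesgue_measure_itv /= lte_fin /hat.
case: ltP => h.
  rewrite -EFinB; congr EFin; rewrite max_r; lra.
rewrite max_l //; lra.
Qed.

Lemma floor_cell_inj v v' z (t : R) : floor_cell v z t -> floor_cell v' z t -> v = v'.
Proof.
move=> [_ h] [_ h']; apply/rowP => i.
have /andP[a1 a2] := h i; have /andP[b1 b2] := h' i.
have h1 : (v ord0 i)%:~R < (v' ord0 i + 1)%:~R :> R by rewrite intrD; lra.
have h2 : (v' ord0 i)%:~R < (v ord0 i + 1)%:~R :> R by rewrite intrD; lra.
by move: h1 h2; rewrite !ltr_int !ltzD1 => h1 h2; apply/eqP; rewrite eq_le h1 h2.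
Qed.

Lemma floor_cell_floor z (t : R) : 0 <= t < 1 ->
  floor_cell (\row_i Num.floor (z ord0 i + t)) z t.
Proof.
by move=> t01; split => // i; rewrite mxE -[_ + 1]intrD1 floor_itv ?num_real.
Qed.

Definition hat_sum F z : R := \sum_(v <- F) hat v z.

Lemma hat_sumE F z :
  (hat_sum F z)%:E = lebesgue_measure (\bigcup_(v in [set` F]) floor_cell v z).
Proof.
rewrite bigcup_fset measure_fbigsetU.
- by rewrite -sumEFin; apply: eq_bigr => v _; exact/esym/floor_cell_measure.
- by move=> v _; rewrite floor_cellE.
- by move=> v w _ _ [t [? ?]]; apply: floor_cell_inj; eassumption.
Qed.

Lemma measurable_floor_cells F z :
  measurable (\bigcup_(v in [set` F]) floor_cell v z).
Proof.
rewrite bigcup_fset; apply: bigsetU_measurable => v _; rewrite floor_cellE //.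
Qed.

(** The cells of distinct vertices are disjoint subsets of [0, 1[, and the hat values are their
    lengths. *)
Lemma hat_sum_le1 F z : hat_sum F z <= 1.
Proof.
rewrite -lee_fin hat_sumE.
have <- : lebesgue_measure (`[0, 1[%classic : set R) = 1%:E :> \bar R.
  by rewrite lebesgue_measure_itv /= lte_fin ltr01 -EFinB subr0.
apply: le_measure; rewrite ?inE //; first exact: measurable_floor_cells.
by move=> t [v _ [? _]]; rewrite /= in_itv.
Qed.

(** A coupling argument: using the same uniform [t] for both points turns an inequality between real
    functions into a statement about floors. *)
Lemma le_hat_sum F z z' :
  (forall v (t : R), v \in F -> floor_cell v z t ->
     exists2 v', v' \in F & floor_cell v' z' t) ->
  hat_sum F z <= hat_sum F z'.
Proof.
move=> h; rewrite -lee_fin !hat_sumE.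
apply: le_measure; rewrite ?inE; try exact: measurable_floor_cells.
by move=> t [v vF /(h _ _ vF)[v' ? ?]]; exists v'.
Qed.

End Kuhn.

Lemma row_ord0P (T : Type) (n : nat) (x y : 'rV[T]_n) :
  (forall i, x ord0 i = y ord0 i) -> x = y.
Proof. by move=> h; apply/rowP => i; exact: h. Qed.

Section KuhnChain.
Variables (R : realType) (d : nat).
Local Notation space := 'rV[R]_d.
Implicit Types (z : space) (u v x y : vertex d) (V : {fset vertex d}) (w : vertex d -> R).
Local Notation lp := (lattice_point R).

Definition vle x y : bool := [forall i, x ord0 i <= y ord0 i].

Definition kuhn x y : bool :=
  (vle x y || vle y x) && [forall i, `|x ord0 i - y ord0 i| <= 1].

(** The triangulation is a flag complex: a nonempty set of vertices spans a simplex as soon as its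
    vertices are pairwise joined by edges. *)
Definition kuhn_chain V : Prop := forall x y, x \in V -> y \in V -> kuhn x y.

Definition barycenter V w : space := \sum_(v <- V) w v *: lp v.

Lemma vleP x y : reflect (forall i, x ord0 i <= y ord0 i) (vle x y).
Proof. exact: forallP. Qed.

Lemma kuhnC x y : kuhn x y = kuhn y x.
Proof.
rewrite /kuhn orbC; congr (_ && _).
by apply: eq_forallb => i; rewrite distrC.
Qed.

Lemma kuhn_refl x : kuhn x x.
Proof.
rewrite /kuhn; apply/andP; split; first by apply/orP; left; apply/vleP.
by apply/forallP => i; rewrite subrr normr0.
Qed.

Lemma barycenterE V w i : barycenter V w ord0 i = \sum_(v <- V) w v * (v ord0 i)%:~R.
Proof. by rewrite summxE; apply: eq_bigr => v _; rewrite !mxE. Qed.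

(** A coordinate of [z - v] is at most the mass of the vertices above [v], and one of [v - z] at
    most the mass of those below. What these two masses leave of 1 is the weight of [v]. *)
Let weight_le_hat V w v : kuhn_chain V -> (forall v, v \in V -> 0 <= w v) ->
  \sum_(v <- V) w v = 1 -> v \in V -> w v <= hat v (barycenter V w).
Proof.
move=> chV w0 w1 vV; set z := barycenter V w.
pose mgt := \sum_(u <- V | (u != v) && vle v u) w u.
pose mlt := \sum_(u <- V | (u != v) && ~~ vle v u) w u.
have sumE : w v + (mgt + mlt) = 1.
  rewrite -w1 (bigD1_seq v) //= ?fset_uniq //; congr (_ + _).
  by rewrite [RHS](bigID (fun u => vle v u)).
have coord i : z ord0 i - (v ord0 i)%:~R = \sum_(u <- V) w u * (u ord0 i - v ord0 i)%:~R.
  under eq_bigr do rewrite intrB mulrBr.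
  by rewrite sumrB -mulr_suml w1 mul1r barycenterE.
have le1 u i : u \in V -> (u ord0 i - v ord0 i <= 1) && (v ord0 i - u ord0 i <= 1).
  move=> uV; have /andP[_ /forallP /(_ i)] := chV _ _ uV vV.
  by rewrite ler_norml => /andP[? ?]; apply/andP; split => //; rewrite -opprB lerNl.
have pgt : peak (z - lp v) <= mgt.
  apply: peak_leP => [|i]; first by rewrite /mgt big_seq_cond sumr_ge0 // => u /andP[/w0].
  rewrite !mxE coord /mgt [leRHS]big_mkcond big_seq [leRHS]big_seq.
  apply: ler_sum => u uV; case: ifPn => [/andP[_ vu]|].
    rewrite -[leRHS]mulr1 ler_wpM2l ?w0 //.
    by have /andP[+ _] := le1 u i uV; rewrite -(ler_int R).
  rewrite negb_and negbK => /orP[/eqP ->|nvu]; first by rewrite subrr mulr0.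
  have /andP[/orP[/vleP uv|vu] _] := chV _ _ uV vV; last by rewrite vu in nvu.
  by rewrite mulr_ge0_le0 ?w0 // -[0]/(0%:~R) ler_int subr_le0.
have plt : peak (lp v - z) <= mlt.
  apply: peak_leP => [|i]; first by rewrite /mlt big_seq_cond sumr_ge0 // => u /andP[/w0].
  rewrite !mxE -opprB coord -sumrN /mlt [leRHS]big_mkcond big_seq [leRHS]big_seq.
  apply: ler_sum => u uV; rewrite -mulrN -intrN opprB; case: ifPn => [/andP[_ vu]|].
    rewrite -[leRHS]mulr1 ler_wpM2l ?w0 //.
    by have /andP[_ +] := le1 u i uV; rewrite -(ler_int R).
  rewrite negb_and !negbK => /orP[/eqP ->|/vleP vu]; first by rewrite subrr mulr0.
  by rewrite mulr_ge0_le0 ?w0 // -[0]/(0%:~R) ler_int subr_le0.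
rewrite /hat le_max; apply/orP; right; lra.
Qed.

(* The hat functions dominate the weights of the chain and sum to at most one,
   which leaves no room for anything else. *)
Lemma hat_barycenter V w v : kuhn_chain V -> (forall v, v \in V -> 0 <= w v) ->
  \sum_(v <- V) w v = 1 ->
  hat v (barycenter V w) = if v \in V then w v else 0.
Proof.
move=> chV w0 w1; set z := barycenter V w.
have sumV : \sum_(u <- V) (hat u z - w u) <= 0.
  by rewrite sumrB w1 subr_le0; exact: hat_sum_le1.
have ge0 u : u \in V -> 0 <= hat u z - w u.
  by move=> uV; rewrite subr_ge0; exact: weight_le_hat.
case: ifPn => vV.
  apply/eqP; rewrite -subr_eq0 eq_le ge0 // andbT.
  apply: le_trans sumV; rewrite (bigD1_seq v) //= ?fset_uniq // lerDl.
  by rewrite big_seq_cond sumr_ge0 // => u /andP[/ge0].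
apply/eqP; rewrite eq_le hat_ge0 andbT.
have := hat_sum_le1 (v |` V)%fset z.
rewrite /hat_sum big_fsetU1 //= -[leRHS]w1 -lerBrDr -sumrB => /le_trans; apply.
rewrite -oppr_ge0 -sumrN big_seq sumr_ge0 // => u uV.
by rewrite opprB ge0.
Qed.

Lemma hat_sum_barycenter (A : {fset vertex d}) V w :
  kuhn_chain V -> (forall v, v \in V -> 0 <= w v) -> \sum_(v <- V) w v = 1 ->
  hat_sum A (barycenter V w) = \sum_(v <- V) w v * (v \in A)%:R.
Proof.
move=> chV w0 w1; rewrite /hat_sum.
under eq_bigr do rewrite hat_barycenter //.
under [RHS]eq_bigr do rewrite mulr_natr mulrb.
rewrite -!big_mkcond -big_filter -[RHS]big_filter; apply: perm_big.
apply: uniq_perm; rewrite ?filter_uniq ?fset_uniq // => v.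
by rewrite !mem_filter andbC.
Qed.

Definition l1 z : R := \sum_i `|z ord0 i|.

(** Integer coordinates that differ by at most 1 cannot take both signs, so each absolute value is
    linear on a simplex of the triangulation. *)
Lemma l1_barycenter V w : kuhn_chain V -> (forall v, v \in V -> 0 <= w v) ->
  l1 (barycenter V w) = \sum_(v <- V) w v * l1 (lp v).
Proof.
move=> chV w0.
transitivity (\sum_i \sum_(v <- V) w v * `|v ord0 i|%:~R :> R); last first.
  rewrite exchange_big; apply: eq_bigr => v _; rewrite mulr_sumr.
  by apply: eq_bigr => i _; rewrite mxE intr_norm.
apply: eq_bigr => i _; rewrite barycenterE.
have [/hasP[u uV u0]|/hasPn nn] := boolP (has (fun u : vertex d => 0 < u ord0 i) V).
  have v0 v : v \in V -> 0 <= v ord0 i.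
    move=> vV; have /andP[_ /forallP /(_ i)] := chV _ _ uV vV.
    by rewrite ler_norml => /andP[_]; move: u0; lia.
  rewrite ger0_norm; last first.
    rewrite big_seq sumr_ge0 // => v vV; rewrite mulr_ge0 ?w0 //.
    by rewrite ler0z v0.
  rewrite big_seq [RHS]big_seq; apply: eq_bigr => v vV.
  by rewrite ger0_norm ?v0.
have v0 v : v \in V -> v ord0 i <= 0 by move=> /nn; rewrite -leNgt.
rewrite ler0_norm; last first.
  rewrite -oppr_ge0 -sumrN big_seq sumr_ge0 // => v vV.
  by rewrite -mulrN mulr_ge0 ?w0 // oppr_ge0 lerz0 v0.
rewrite -sumrN big_seq [RHS]big_seq; apply: eq_bigr => v vV.
by rewrite ler0_norm ?v0 // intrN mulrN.
Qed.

(** Induction on the number of nonzero coordinates of [y]: the vertex [v0] plus the indicator of the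
    support of [y] receives the least nonzero coordinate as its weight, and subtracting it shrinks
    the support. The total mass [M] varies because each round consumes part of it; the remainder
    ends up on [v0]. *)
Let peel (n : nat) (v0 : vertex d) (y : space) (M : R) :
  (forall i, 0 <= y ord0 i <= M) -> 0 <= M -> (#|[pred i | y ord0 i != 0%R]| <= n)%N ->
  exists V w,
    [/\ kuhn_chain V,
        forall v, v \in V -> forall i,
          v0 ord0 i <= v ord0 i <= v0 ord0 i + (y ord0 i != 0)%:Z,
        forall v, v \in V -> 0 <= w v,
        \sum_(v <- V) w v = M &
        \sum_(v <- V) w v *: (lp v - lp v0) = y].
Proof.
elim: n y M => [|n IH] y M yM M0 cardn.
  have y0 : y = 0.
    apply/rowP => i; rewrite mxE; apply/eqP/negPn/negP => yi.
    by move: cardn; rewrite leqn0 => /eqP/card0_eq /(_ i); rewrite inE yi.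
  exists [fset v0]%fset, (fun=> M); rewrite !big_seq_fset1 subrr scaler0 y0; split=> //.
    by move=> ? ? /fset1P -> /fset1P ->; exact: kuhn_refl.
  by move=> v /fset1P -> i; rewrite lexx mxE eqxx addr0 lexx.
have [/existsP[i1 hi1]|/existsPn nall] := boolP [exists i, y ord0 i != 0]; last first.
  by apply: IH => //; rewrite eq_card0 // => i; rewrite inE; apply/negbTE/nall.
pose i0 := [arg min_(i < i1 | y ord0 i != 0) y ord0 i]%O.
have [yi0 mini0] : y ord0 i0 != 0 /\ forall i, y ord0 i != 0 -> y ord0 i0 <= y ord0 i.
  by rewrite /i0; case: arg_minP.
set m := y ord0 i0 in yi0 mini0.
have /andP[m0 mM] := yM i0; rewrite -/m in m0 mM.
pose y' : space := \row_i (if y ord0 i != 0 then y ord0 i - m else 0).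
pose vS : vertex d := \row_i (v0 ord0 i + (y ord0 i != 0)%:Z).
have y'0 i : y' ord0 i != 0 -> y ord0 i != 0 by rewrite mxE; case: ifP; rewrite ?eqxx.
have y'i0 : y' ord0 i0 = 0 by rewrite mxE yi0 subrr.
have [||| V' [w' [chV' bV' w'0 w'M w'y]]] := IH y' (M - m).
- move=> i; rewrite mxE; case: ifPn => [yi|_]; last by rewrite lexx subr_ge0.
  by rewrite subr_ge0 mini0 //= lerD2r; case/andP: (yM i).
- by rewrite subr_ge0.
- rewrite -ltnS; apply: leq_trans cardn; apply: proper_card; apply/properP; split.
    by apply/fintype.subsetP => i; rewrite !inE; exact: y'0.
  by exists i0; rewrite !inE // y'i0 eqxx.
have vSV' : vS \notin V'.
  apply/negP => /bV' /(_ i0) /andP[_]; rewrite mxE y'i0 eqxx yi0 /=; lia.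
have b' v : v \in V' -> forall i, v0 ord0 i <= v ord0 i <= vS ord0 i.
  move=> /bV' h i; have /andP[-> /=] := h i; move=> /le_trans; apply.
  rewrite [vS _ _]mxE lerD2l; by case: (y' ord0 i =P 0) => [_|/eqP/y'0 -> //]; case: (_ != 0).
have bS i : vS ord0 i <= v0 ord0 i + 1 by rewrite mxE lerD2l; case: (_ != 0).
have chS v : v \in V' -> kuhn v vS.
  move=> /b' h; apply/andP; split.
    by apply/orP; left; apply/vleP => i; case/andP: (h i).
  apply/forallP => i; rewrite ler_norml; have /andP[] := h i; have := bS i; lia.
exists (vS |` V')%fset, (fun v => if v == vS then m else w' v).
have sumE (E : lmodType R) (h : vertex d -> E) :
  \sum_(v <- V') (if v == vS then m else w' v) *: h v = \sum_(v <- V') w' v *: h v.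
  rewrite big_seq [RHS]big_seq; apply: eq_bigr => v vV; case: eqP => // vE.
  by rewrite -vE vV in vSV'.
split.
- move=> x y1; rewrite !inE => /predU1P[->|xV] /predU1P[->|yV].
  + exact: kuhn_refl.
  + by rewrite kuhnC chS.
  + exact: chS.
  + exact: chV'.
- move=> v; rewrite !inE => /predU1P[->|vV] i.
    by rewrite mxE lexx andbT lerDl; case: (_ != 0).
  have /andP[-> le2] := b' _ vV i; rewrite /= (le_trans le2) //.
  by rewrite /vS mxE.
- by move=> v; rewrite !inE; case: eqP => //= _ /w'0.
- rewrite big_fsetU1 //= eqxx.
  have := sumE R^o (fun=> 1); rewrite -!scaler_suml.
  rewrite w'M => /(congr1 (fun x : R => x)); rewrite /GRing.scale /= !mulr1 => ->.
  by rewrite addrC subrK.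
- rewrite big_fsetU1 //= eqxx sumE w'y.
  apply: row_ord0P => i; rewrite !mxE intrD.
  case: eqP => [y0|_] /=; first by rewrite y0 mulr0z; ring.
  by rewrite mulr1z; ring.
Qed.

(** The fractional parts of [z] are peeled off from the corner given by the floors. *)
Lemma kuhn_decomposition z : exists V w,
  [/\ kuhn_chain V, forall v, v \in V -> 0 <= w v, \sum_(v <- V) w v = 1 &
      z = barycenter V w].
Proof.
pose v0 : vertex d := \row_i Num.floor (z ord0 i).
have [||| V [w [chV _ w0 w1 wz]]] := @peel d v0 (z - lp v0) 1.
- move=> i; rewrite !mxE; have := floor_itv (z ord0 i); rewrite ?num_real // intrD1.
  by move=> /andP[? ?]; apply/andP; split; lra.
- exact: ler01.
- by rewrite (leq_trans (max_card _)) // card_ord.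
exists V, w; split=> //; rewrite /barycenter.
have -> : z = \sum_(v <- V) w v *: (lp v - lp v0) + lp v0 by rewrite wz subrK.
under eq_bigr do rewrite scalerBr.
by rewrite sumrB -scaler_suml w1 scale1r subrK.
Qed.

End KuhnChain.

(** * Triangulating a level set *)

Lemma exists_min_seq (T : eqType) (f : T -> int) (s : seq T) (x : T) : x \in s ->
  exists2 y, y \in s & forall z, z \in s -> f y <= f z.
Proof.
elim: s x => // a s IH x _.
case: s IH => [|b s] IH; first by exists a; rewrite ?mem_head // => z; rewrite inE => /eqP ->.
have [y ys hy] := IH b (mem_head _ _).
have [ay|ya] := leP (f a) (f y).
  exists a; rewrite ?mem_head // => z; rewrite inE => /predU1P[->//|/hy].
  exact: le_trans.
exists y; first by rewrite inE ys orbT.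
by move=> z; rewrite inE => /predU1P[->|/hy//]; exact: ltW.
Qed.

Section Height.
Variable d : nat.
Implicit Types x y : vertex d.

Definition height x : int := \sum_i x ord0 i.

Lemma vle_height x y : vle x y -> height y <= height x -> x = y.
Proof.
move=> /vleP xy yx.
have e : \sum_i (y ord0 i - x ord0 i) == 0.
  by rewrite eq_le sumr_ge0 ?andbT ?sumrB ?subr_le0 // => i _; rewrite subr_ge0.
apply: row_ord0P => i; move: e; rewrite psumr_eq0 => [/allP /(_ i)|j _].
  by rewrite mem_index_enum subr_eq0 => /(_ isT) /eqP.
by rewrite subr_ge0.
Qed.

End Height.

Section Coupling.
Variables (R : realType) (d : nat).
Implicit Types (p q : vertex d * vertex d) (D : {fset vertex d * vertex d}).

Definition pair_le p q : bool := vle p.1 q.1 && vle p.2 q.2.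

(* At a pair of minimal height where the couplings differ, the marginals force the
   smaller one to charge an incomparable couple of pairs in the same row and column. *)
Let coupling_le D (g g' : vertex d * vertex d -> R) p0 :
  (forall p, 0 <= g p) ->
  (forall p q, p \in D -> q \in D -> 0 < g' p -> 0 < g' q -> pair_le p q || pair_le q p) ->
  (forall v, \sum_(p <- D | p.1 == v) g p = \sum_(p <- D | p.1 == v) g' p) ->
  (forall v, \sum_(p <- D | p.2 == v) g p = \sum_(p <- D | p.2 == v) g' p) ->
  p0 \in D ->
  (forall p, p \in D -> g p != g' p -> height p0.1 + height p0.2 <= height p.1 + height p.2) ->
  g p0 <= g' p0.
Proof.
move=> g0 chain m1 m2 p0D min0; rewrite leNgt; apply/negP => lt0.
have ex (P : pred (vertex d * vertex d)) : P p0 ->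
    \sum_(p <- D | P p) g p = \sum_(p <- D | P p) g' p ->
    exists p, [/\ p \in D, P p, p != p0 & g p < g' p].
  move=> P0 e; apply: contrapT => no.
  suff : \sum_(p <- D | P p) g' p < \sum_(p <- D | P p) g p by rewrite e ltxx.
  rewrite big_mkcond [ltRHS]big_mkcond (bigD1_seq p0) ?fset_uniq //=.
  rewrite [ltRHS](bigD1_seq p0) ?fset_uniq //= P0.
  apply: ltr_leD => //; rewrite big_seq_cond [leRHS]big_seq_cond; apply: ler_sum.
  move=> p /andP[pD pp0]; case: ifPn => // pP; rewrite leNgt; apply/negP => lt.
  by apply: no; exists p.
have [[a1 b1] [D1 /eqP /= e1 n1 l1]] := ex (fun p => p.1 == p0.1) (eqxx _) (m1 _).
have [[a2 b2] [D2 /eqP /= e2 n2 l2]] := ex (fun p => p.2 == p0.2) (eqxx _) (m2 _).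
have h1 := min0 _ D1 (negbT (lt_eqF l1)).
have h2 := min0 _ D2 (negbT (lt_eqF l2)).
rewrite /= e1 lerD2l in h1; rewrite /= e2 lerD2r in h2.
have := chain _ _ D1 D2 (le_lt_trans (g0 _) l1) (le_lt_trans (g0 _) l2).
rewrite /pair_le /= e1 e2 => /orP[/andP[_ l]|/andP[l _]].
  have e := vle_height l h1; move: n1.
  by rewrite e1 e -surjective_pairing eqxx.
have e := vle_height l h2; move: n2.
by rewrite e2 e -surjective_pairing eqxx.
Qed.

(** At a pair of least total height where the couplings differ, [coupling_le] applies in both
    directions and gives equality. *)
Lemma monotone_coupling_unique D (g g' : vertex d * vertex d -> R) :
  (forall p, 0 <= g p) -> (forall p, 0 <= g' p) ->
  (forall p q, p \in D -> q \in D -> 0 < g p -> 0 < g q -> pair_le p q || pair_le q p) ->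
  (forall p q, p \in D -> q \in D -> 0 < g' p -> 0 < g' q -> pair_le p q || pair_le q p) ->
  (forall v, \sum_(p <- D | p.1 == v) g p = \sum_(p <- D | p.1 == v) g' p) ->
  (forall v, \sum_(p <- D | p.2 == v) g p = \sum_(p <- D | p.2 == v) g' p) ->
  forall p, p \in D -> g p = g' p.
Proof.
move=> g0 g'0 ch ch' m1 m2 p pD; apply: contrapT => /eqP ne.
have pE : p \in [seq p <- D | g p != g' p] by rewrite mem_filter ne.
have [q] := exists_min_seq (fun p => height p.1 + height p.2) pE.
rewrite mem_filter => /andP[neq qD] minq.
have minq' r : r \in D -> g r != g' r -> height q.1 + height q.2 <= height r.1 + height r.2.
  by move=> rD ner; apply: minq; rewrite mem_filter ner.
move/negP: neq; apply; rewrite eq_le; apply/andP; split.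
  exact: (coupling_le g0 ch' m1 m2 qD).
apply: (coupling_le g'0 ch _ _ qD) => // r rD; rewrite eq_sym; exact: minq'.
Qed.

End Coupling.

Section Staircase.
Variables (R : realType) (d : nat) (h : vertex d -> R).
Local Notation space := 'rV[R]_d.
Local Notation lp := (lattice_point R).
Hypothesis h_neq0 : forall v, h v != 0.
Implicit Types (p q : vertex d * vertex d) (P Q : {fset vertex d * vertex d}).

(** Once divided by [ray_mass], this is the point of the segment from [p.1] to [p.2] where the
    affine interpolation of [h] vanishes. Unnormalized, its two coefficients times the values of [h]
    are 1 and -1, so coefficients [g] on rays behave as a coupling with mass [g p] at [p]. *)
Definition ray p : space := (h p.1)^-1 *: lp p.1 - (h p.2)^-1 *: lp p.2.
Definition ray_mass p : R := (h p.1)^-1 - (h p.2)^-1.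
Definition crossing p : space := (ray_mass p)^-1 *: ray p.

Definition edge_pair p : bool := [&& 0 < h p.1, h p.2 < 0 & kuhn p.1 p.2].

(* The simplices of the staircase triangulation of the cell cut out of a Kuhn
   simplex: the cell is a product of two simplices. *)
Definition staircase P : Prop :=
  (forall p, p \in P -> edge_pair p) /\
  (forall p q, p \in P -> q \in P ->
     [/\ kuhn p.1 q.1, kuhn p.1 q.2, kuhn p.2 q.2 & pair_le p q || pair_le q p]).

Lemma staircase_sub P Q : (Q `<=` P)%fset -> staircase P -> staircase Q.
Proof.
move=> /fsubsetP QP [e c]; split; first by move=> p /QP /e.
by move=> p q /QP pP /QP qP; exact: c.
Qed.

Lemma ray_mass_gt0 p : edge_pair p -> 0 < ray_mass p.
Proof.
move=> /and3P[a b _]; rewrite /ray_mass subr_gt0.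
by apply: (@lt_trans _ _ 0); rewrite ?invr_gt0 ?invr_lt0.
Qed.

Definition ends P : {fset vertex d} :=
  ([fset p.1 | p in P] `|` [fset p.2 | p in P])%fset.

(** The coefficient of the lattice point [v] in the combination of rays with coefficients [g]. For a
    staircase only one of the two sums can be nonzero, according to the sign of [h v], so this is a
    marginal of [g] divided by the modulus of [h v]. *)
Definition end_weight P (g : vertex d * vertex d -> R) (v : vertex d) : R :=
  (h v)^-1 * \sum_(p <- P | p.1 == v) g p - (h v)^-1 * \sum_(p <- P | p.2 == v) g p.

Lemma mem_ends1 P p : p \in P -> p.1 \in ends P.
Proof. by move=> pP; rewrite inE; apply/orP; left; apply/imfsetP; exists p. Qed.

Lemma mem_ends2 P p : p \in P -> p.2 \in ends P.
Proof. by move=> pP; rewrite inE; apply/orP; right; apply/imfsetP; exists p. Qed.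

Lemma endsP P v : v \in ends P -> exists2 p, p \in P & v = p.1 \/ v = p.2.
Proof.
by rewrite inE => /orP[] /imfsetP[p pP ->]; exists p => //; [left|right].
Qed.

Lemma staircase_ends P : staircase P -> kuhn_chain (ends P).
Proof.
move=> [_ c] x y /endsP[p pP ep] /endsP[q qP eq].
have [c1 c2 c3 _] := c _ _ pP qP; have [_ c4 _ _] := c _ _ qP pP.
by case: ep => ->; case: eq => -> //; rewrite kuhnC.
Qed.

(** The target module is arbitrary so that one identity yields the point ([f] the lattice
    embedding), the total mass ([f] constant 1) and the value of the interpolation ([f] equal to
    [h]). *)
Lemma sum_ends (E : lmodType R) (f : vertex d -> E) P (g : vertex d * vertex d -> R) :
  \sum_(v <- ends P) end_weight P g v *: f v =
  \sum_(p <- P) g p *: ((h p.1)^-1 *: f p.1 - (h p.2)^-1 *: f p.2).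
Proof.
have part (sel : vertex d * vertex d -> vertex d) : (forall p, p \in P -> sel p \in ends P) ->
    \sum_(v <- ends P) ((h v)^-1 * \sum_(p <- P | sel p == v) g p) *: f v =
    \sum_(p <- P) g p *: ((h (sel p))^-1 *: f (sel p)).
  move=> selP.
  under eq_bigr do rewrite big_mkcond mulr_sumr scaler_suml.
  rewrite exchange_big /= big_seq [RHS]big_seq; apply: eq_bigr => p /selP pe.
  rewrite (bigD1_seq (sel p)) ?fset_uniq //= eqxx big1 ?addr0.
    by rewrite scalerA mulrC.
  by move=> v; rewrite eq_sym => /negbTE ->; rewrite mulr0 scale0r.
under eq_bigr do rewrite scalerBl.
rewrite sumrB (part fst) ?(part snd); [|exact: mem_ends2|exact: mem_ends1].
by rewrite -sumrB; apply: eq_bigr => p _; rewrite scalerBr.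
Qed.

Section Rep.
Variables (P : {fset vertex d * vertex d}) (g : vertex d * vertex d -> R).
Hypotheses (stP : staircase P) (g0 : forall p, p \in P -> 0 <= g p).

Lemma end_weight_pos v : 0 < h v -> end_weight P g v = (h v)^-1 * \sum_(p <- P | p.1 == v) g p.
Proof.
move=> hv; rewrite /end_weight [X in _ - _ * X]big1_seq ?mulr0 ?subr0 //.
move=> p /andP[/eqP pv pP]; have /and3P[_ + _] := stP.1 _ pP.
by rewrite pv ltNge (ltW hv).
Qed.

Lemma end_weight_neg v : h v < 0 -> end_weight P g v = - (h v)^-1 * \sum_(p <- P | p.2 == v) g p.
Proof.
move=> hv; rewrite /end_weight [X in _ * X - _]big1_seq ?mulr0 ?sub0r ?mulNr //.
move=> p /andP[/eqP pv pP]; have /and3P[+ _ _] := stP.1 _ pP.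
by rewrite pv ltNge (ltW hv).
Qed.

Lemma end_weight_ge0 v : 0 <= end_weight P g v.
Proof.
have s0 (C : pred (vertex d * vertex d)) : 0 <= \sum_(p <- P | C p) g p.
  by rewrite big_seq_cond sumr_ge0 // => p /andP[/g0].
have := h_neq0 v; rewrite neq_lt => /orP[hv|hv].
  by rewrite end_weight_neg // mulr_ge0 // oppr_ge0 invr_le0 ltW.
by rewrite end_weight_pos // mulr_ge0 // invr_ge0 ltW.
Qed.

Lemma end_weight_out v : v \notin ends P -> end_weight P g v = 0.
Proof.
move=> nv; rewrite /end_weight !big1_seq ?mulr0 ?subrr // => p /andP[/eqP pv pP].
  by move: nv; rewrite -pv mem_ends2.
by move: nv; rewrite -pv mem_ends1.
Qed.

Hypothesis g1 : \sum_(p <- P) g p * ray_mass p = 1.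

Lemma sum_end_weight : \sum_(v <- ends P) end_weight P g v = 1.
Proof.
have := @sum_ends R^o (fun=> 1) P g; rewrite /GRing.scale /=.
under eq_bigr do rewrite mulr1.
move=> ->; rewrite -[RHS]g1; apply: eq_bigr => p _.
by rewrite !mulr1.
Qed.

(** The ends of a staircase form a simplex of the triangulation, whose barycentric coordinates the
    hat functions recover. Hence the point alone determines both marginals of [g]. *)
Lemma hat_end_weight v : hat v (\sum_(p <- P) g p *: ray p) = end_weight P g v.
Proof.
rewrite -(sum_ends (@lattice_point R d)) -[X in hat v X]/(barycenter _ _) hat_barycenter.
- by case: ifPn => // /end_weight_out.
- exact: staircase_ends.
- by move=> *; exact: end_weight_ge0.
- exact: sum_end_weight.
Qed.

End Rep.

(** Both families of coefficients, extended by 0 to the union of [P] and [Q], are couplings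
    supported on chains of pairs, and they have the same marginals by [hat_end_weight]. Monotone
    couplings are unique. *)
Lemma staircase_unique P Q (g g' : vertex d * vertex d -> R) :
  staircase P -> staircase Q ->
  (forall p, p \in P -> 0 <= g p) -> (forall p, p \in Q -> 0 <= g' p) ->
  \sum_(p <- P) g p * ray_mass p = 1 -> \sum_(p <- Q) g' p * ray_mass p = 1 ->
  \sum_(p <- P) g p *: ray p = \sum_(p <- Q) g' p *: ray p ->
  forall p, (if p \in P then g p else 0) = (if p \in Q then g' p else 0).
Proof.
move=> sP sQ g0 g'0 g1 g'1 e p.
have we v : end_weight P g v = end_weight Q g' v.
  by rewrite -!hat_end_weight // e.
pose k (S : {fset vertex d * vertex d}) (f : vertex d * vertex d -> R) q :=
  if q \in S then f q else 0.
have kE (S : {fset vertex d * vertex d}) f (C : pred (vertex d * vertex d)) :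
    (S `<=` P `|` Q)%fset ->
    \sum_(q <- (P `|` Q)%fset | C q) k S f q = \sum_(q <- S | C q) f q.
  move=> /fsubsetP sub; rewrite /k -big_mkcondr -big_filter -[RHS]big_filter.
  apply: perm_big; apply: uniq_perm; rewrite ?filter_uniq ?fset_uniq // => q.
  rewrite !mem_filter; case: (boolP (q \in S)) => [/sub ->|]; rewrite ?andbT ?andbF //.
have PU : (P `<=` P `|` Q)%fset by exact: fsubsetUl.
have QU : (Q `<=` P `|` Q)%fset by exact: fsubsetUr.
have [pD|pD] := boolP (p \in (P `|` Q)%fset); last first.
  by move: pD; rewrite inE negb_or => /andP[/negbTE -> /negbTE ->].
have ch S f : staircase S -> forall q r, 0 < k S f q -> 0 < k S f r -> pair_le q r || pair_le r q.
  move=> [_ c] q r; rewrite /k; case: ifPn => [qS _|_]; rewrite ?ltxx //.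
  by case: ifPn => [rS _|_]; rewrite ?ltxx // ; case: (c _ _ qS rS).
apply: (@monotone_coupling_unique R d (P `|` Q)%fset (k P g) (k Q g')) => //.
- by move=> q; rewrite /k; case: ifP => // /g0.
- by move=> q; rewrite /k; case: ifP => // /g'0.
- by move=> q r _ _; exact: ch.
- by move=> q r _ _; exact: ch.
- move=> v; rewrite !kE //; have := h_neq0 v; rewrite neq_lt => /orP[hv|hv].
    rewrite !big1_seq // => q /andP[/eqP qv qP].
      by have /and3P[+ _ _] := sQ.1 _ qP; rewrite qv ltNge (ltW hv).
    by have /and3P[+ _ _] := sP.1 _ qP; rewrite qv ltNge (ltW hv).
  have := we v; rewrite !end_weight_pos // => /mulfI; apply.
  by rewrite invr_eq0.
- move=> v; rewrite !kE //; have := h_neq0 v; rewrite neq_lt => /orP[hv|hv].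
    have := we v; rewrite !end_weight_neg // => /mulfI; apply.
    by rewrite oppr_eq0 invr_eq0.
  rewrite !big1_seq // => q /andP[/eqP qv qP].
    by have /and3P[_ + _] := sQ.1 _ qP; rewrite qv ltNge (ltW hv).
  by have /and3P[_ + _] := sP.1 _ qP; rewrite qv ltNge (ltW hv).
Qed.

(* The north-west corner rule: match the lowest vertex on each side. *)
Lemma staircase_decomposition (V : {fset vertex d}) (w : vertex d -> R) :
  kuhn_chain V -> (forall v, v \in V -> 0 < w v) -> \sum_(v <- V) w v * h v = 0 ->
  exists P g,
    [/\ staircase P,
        forall p, p \in P -> (p.1 \in V) && (p.2 \in V),
        forall p, p \in P -> 0 < g p &
        forall (E : lmodType R) (f : vertex d -> E),
          \sum_(v <- V) w v *: f v =
          \sum_(p <- P) g p *: ((h p.1)^-1 *: f p.1 - (h p.2)^-1 *: f p.2)].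
Proof.
have [n] := ubnP #|` V|; elim: n V w => // n IH V w cardV chV w0 wh0.
have [->|/fset0Pn[v1 v1V]] := eqVneq V fset0.
  by exists fset0, (fun=> 0); split => // E f; rewrite !big_seq_fset0.
have [a1 a1V a1h] : exists2 a, a \in V & 0 < h a.
  apply: contrapT => no.
  suff : \sum_(v <- V) w v * h v < 0 by rewrite wh0 ltxx.
  rewrite (bigD1_seq v1) ?fset_uniq //= -[ltRHS]addr0; apply: ltr_leD.
    rewrite pmulr_rlt0 ?w0 // lt_neqAle h_neq0 leNgt.
    by apply/negP => hv; apply: no; exists v1.
  rewrite -oppr_ge0 -sumrN big_seq_cond sumr_ge0 // => v /andP[vV _].
  rewrite -mulrN mulr_ge0 ?(ltW (w0 _ vV)) // oppr_ge0 leNgt.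
  by apply/negP => hv; apply: no; exists v.
have [b1 b1V b1h] : exists2 b, b \in V & h b < 0.
  apply: contrapT => no.
  suff : 0 < \sum_(v <- V) w v * h v by rewrite wh0 ltxx.
  rewrite (bigD1_seq v1) ?fset_uniq //= -[ltLHS]addr0; apply: ltr_leD.
    rewrite pmulr_rgt0 ?w0 // lt_neqAle eq_sym h_neq0 leNgt.
    by apply/negP => hv; apply: no; exists v1.
  rewrite big_seq_cond sumr_ge0 // => v /andP[vV _].
  rewrite mulr_ge0 ?(ltW (w0 _ vV)) // leNgt.
  by apply/negP => hv; apply: no; exists v.
have low (C : pred (vertex d)) c1 : c1 \in V -> C c1 ->
    exists c, [/\ c \in V, C c & forall v, v \in V -> C v -> vle c v].
  move=> cV Cc.
  have c1s : c1 \in [seq v <- V | C v] by rewrite mem_filter Cc.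
  have [c] := exists_min_seq (@height d) c1s.
  rewrite mem_filter => /andP[Cc' cV'] minc; exists c; split => // v vV Cv.
  have /andP[/orP[//|vc] _] := chV _ _ cV' vV.
  rewrite -(vle_height vc); first by apply/vleP.
  by apply: minc; rewrite mem_filter Cv.
have [a [aV ah amin]] := low (fun v => 0 < h v) _ a1V a1h.
have [b [bV bh bmin]] := low (fun v => h v < 0) _ b1V b1h.
(* The largest coefficient of the pair [(a, b)] that keeps the remaining weights nonnegative. It
   exhausts [a] or [b], so fewer vertices remain for the induction. *)
pose M := Num.min (w a * h a) (- (w b * h b)).
have M0 : 0 < M by rewrite lt_min mulr_gt0 ?w0 //= oppr_gt0 pmulr_rlt0 ?w0.
have ab : a != b by apply: contraTneq ah => ->; rewrite -leNgt ltW.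
pose w' v := w v - (if v == a then M / h a else 0) + (if v == b then M / h b else 0).
have w'0 v : v \in V -> 0 <= w' v.
  move=> vV; rewrite /w'; case: eqP => [->|_].
    rewrite (negbTE ab) addr0 subr_ge0 ler_pdivrMr //.
    by rewrite ge_min lexx.
  case: eqP => [->|_]; last by rewrite subr0 addr0 ltW ?w0.
  rewrite subr0 -lerBlDr sub0r -mulNr ler_ndivrMr //.
  by rewrite lerNr ge_min lexx orbT.
pose V' := [fset v in V | 0 < w' v]%fset.
have V'V v : v \in V' -> v \in V by rewrite !inE => /andP[].
have killed : (a \notin V') || (b \notin V').
  rewrite !inE /w' !eqxx (negbTE ab) [b == a]eq_sym (negbTE ab) aV bV /= -!leNgt.
  rewrite addr0 subr0 subr_le0 ler_pdivlMr // /M.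
  case: (leP (w a * h a) (- (w b * h b))) => _; first by rewrite lexx.
  by rewrite mulNr mulfK ?subrr ?lexx ?orbT // lt_eqF.
have sumE (E : lmodType R) (f : vertex d -> E) :
    \sum_(v <- V) w v *: f v =
    M *: ((h a)^-1 *: f a - (h b)^-1 *: f b) + \sum_(v <- V') w' v *: f v.
  have -> : \sum_(v <- V') w' v *: f v = \sum_(v <- V) w' v *: f v.
    rewrite [RHS](bigID (fun v => 0 < w' v)) /= [X in _ + X]big1_seq ?addr0.
      rewrite -[RHS]big_filter; apply: perm_big.
      apply: uniq_perm; rewrite ?filter_uniq ?fset_uniq // => v.
      by rewrite !inE mem_filter andbC.
    move=> v /andP[nv vV]; suff -> : w' v = 0 by rewrite scale0r.
    by apply/eqP; rewrite eq_le w'0 // leNgt nv.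
  rewrite /w'; under [in RHS]eq_bigr do rewrite scalerDl scalerBl.
  rewrite big_split sumrB /=.
  have pick c t : c \in V -> \sum_(v <- V) (if v == c then t else 0) *: f v = t *: f c.
    move=> cV; rewrite (bigD1_seq c) ?fset_uniq //= eqxx big1 ?addr0 //.
    by move=> v /negbTE ->; rewrite scale0r.
  by rewrite !pick // scalerBr !scalerA addrACA addNr addr0 addrC subrK.
have [||||P' [g' [stP' P'V g'0 sumE']]] := IH V' w'.
- rewrite -ltnS; apply: leq_trans cardV; apply: fproper_ltn_card.
  rewrite fproperE; apply/andP; split; first by apply/fsubsetP => v /V'V.
  by apply/negP => /fsubsetP s; case/orP: killed => /negP; apply; exact: s.
- by move=> x y /V'V xV /V'V yV; exact: chV.
- by move=> v; rewrite !inE => /andP[].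
- have := sumE R^o h; rewrite /GRing.scale /= wh0 !mulVf ?h_neq0 //.
  by rewrite subrr mulr0 add0r.
have nP' : (a, b) \notin P'.
  apply/negP => /P'V /=; case/orP: killed => /negbTE -> //.
  by rewrite andbF.
have lowP q : q \in P' -> [/\ kuhn a q.1, kuhn a q.2, kuhn b q.2, kuhn b q.1 & pair_le (a, b) q].
  move=> qP; have /andP[/V'V q1 /V'V q2] := P'V _ qP.
  have /and3P[qa qb _] := stP'.1 _ qP.
  split; try exact: chV.
  by rewrite /pair_le /= amin // bmin.
exists ((a, b) |` P')%fset, (fun p => if p == (a, b) then M else g' p).
have g'E (E : lmodType R) (F : vertex d * vertex d -> E) :
    \sum_(p <- P') (if p == (a, b) then M else g' p) *: F p = \sum_(p <- P') g' p *: F p.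
  rewrite big_seq [RHS]big_seq; apply: eq_bigr => p pP; case: eqP => // e.
  by rewrite -e pP in nP'.
split.
- split.
    move=> p; rewrite !inE => /predU1P[->|]; last exact: stP'.1.
    by rewrite /edge_pair /= ah bh chV.
  move=> p q; rewrite !inE => /predU1P[->|pP] /predU1P[->|qP] /=.
  + split; rewrite ?kuhn_refl ?chV //.
    by apply/orP; left; apply/andP; split; apply/vleP.
  + by have [? ? ? ? ->] := lowP _ qP.
  + have [? ? ? ? ->] := lowP _ pP.
    by split; rewrite ?orbT // kuhnC.
  + exact: stP'.2.
- move=> p; rewrite !inE => /predU1P[->|/P'V /andP[/V'V -> /V'V -> //]].
  by rewrite /= aV bV.
- move=> p; rewrite !inE; case: eqP => //= _; exact: g'0.
- by move=> E f; rewrite big_fsetU1 //= eqxx g'E -sumE' sumE.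
Qed.

End Staircase.

Section UniqueWeights.
Variables (R : realType) (d : nat).
Local Notation space := 'rV[R]_d.
Implicit Types (V W : {fset space}) (K : {fset {fset space}}).

Lemma hull_sub V W : (V `<=` W)%fset -> hull V `<=` hull W.
Proof.
move=> /fsubsetP VW z [w [w0 w1 ->]].
have E (E : lmodType R) (F : space -> E) : \sum_(v <- W) (if v \in V then w v else 0) *: F v =
    \sum_(v <- V) w v *: F v.
  rewrite (eq_bigr (fun v => if v \in V then w v *: F v else 0)); last first.
    by move=> v _; case: ifP; rewrite ?scale0r.
  rewrite -big_mkcond -big_filter; apply: perm_big.
  apply: uniq_perm; rewrite ?filter_uniq ?fset_uniq // => v.
  by rewrite mem_filter; case: (boolP (v \in V)) => // /VW ->.
exists (fun v => if v \in V then w v else 0); split.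
- by move=> v _; case: ifP => // /w0.
- have := E R^o (fun=> 1); rewrite /GRing.scale /=.
  by under eq_bigr do rewrite mulr1; under [RHS]eq_bigr do rewrite mulr1; move=> ->.
- by rewrite E.
Qed.

(** Uniqueness of barycentric coordinates across the whole family. The case of equal simplices gives
    affine independence, the general case gives intersections that are common faces. *)
Definition unique_weights K : Prop := forall V W (w w' : space -> R),
  V \in K -> W \in K ->
  (forall v, v \in V -> 0 <= w v) -> (forall v, v \in W -> 0 <= w' v) ->
  \sum_(v <- V) w v = 1 -> \sum_(v <- W) w' v = 1 ->
  \sum_(v <- V) w v *: v = \sum_(v <- W) w' v *: v ->
  forall v, (if v \in V then w v else 0) = (if v \in W then w' v else 0).

(** The positive and negative parts of an affine dependence have the same sum [s]. If [s] is
    nonzero, dividing by it gives two convex combinations of one point, which must agree. *)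
Lemma unique_weights_affinely_independent K V :
  unique_weights K -> V \in K -> affinely_independent V.
Proof.
move=> uK VK w ws0 wv0.
pose s := \sum_(v <- V) Num.max 0 (w v).
have s_ge0 : 0 <= s by rewrite sumr_ge0 // => v _; rewrite le_max lexx.
have maxN v : Num.max 0 (w v) - Num.max 0 (- w v) = w v.
  by case: (leP 0 (w v)) => h1; case: (leP 0 (- w v)) => h2; lra.
have sN : \sum_(v <- V) Num.max 0 (- w v) = s.
  apply/eqP; rewrite eq_sym -subr_eq0 /s -sumrB.
  by under eq_bigr do rewrite maxN; rewrite ws0.
have [s0|sn0] := eqVneq s 0.
  move=> v vV; have a0 : Num.max 0 (w v) = 0.
    apply/eqP; move: s0 => /eqP; rewrite psumr_eq0; last by move=> u _; rewrite le_max lexx.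
    by move=> /allP /(_ v vV).
  have b0 : Num.max 0 (- w v) = 0.
    apply/eqP; move: sN; rewrite s0 => /eqP.
    rewrite psumr_eq0; last by move=> u _; rewrite le_max lexx.
    by move=> /allP /(_ v vV).
  by rewrite -maxN a0 b0 subrr.
move=> v vV.
have sV : s^-1 * s = 1 by rewrite mulVf.
have : (if v \in V then s^-1 * Num.max 0 (w v) else 0) =
       (if v \in V then s^-1 * Num.max 0 (- w v) else 0).
  apply: (uK V V (fun v => s^-1 * Num.max 0 (w v)) (fun v => s^-1 * Num.max 0 (- w v))) => //.
  - by move=> u _; rewrite mulr_ge0 ?invr_ge0 // le_max lexx.
  - by move=> u _; rewrite mulr_ge0 ?invr_ge0 // le_max lexx.
  - by rewrite -mulr_sumr sV.
  - by rewrite -mulr_sumr sN sV.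
  apply/eqP; rewrite -subr_eq0 -sumrB.
  under eq_bigr do rewrite -scalerBl -mulrBr maxN -scalerA.
  by rewrite -scaler_sumr wv0 scaler0.
rewrite vV => /mulfI e; rewrite -maxN e ?subrr //.
by rewrite invr_eq0.
Qed.

(** The coordinates of a common point relative to [V] and to [W] coincide, so they vanish outside
    the common vertices. *)
Lemma unique_weights_hullI K V W : unique_weights K -> V \in K -> W \in K ->
  hull V `&` hull W = hull (V `&` W)%fset.
Proof.
move=> uK VK WK; apply/seteqP; split; last first.
  by move=> z hz; split; apply: hull_sub hz; [exact: fsubsetIl|exact: fsubsetIr].
move=> z [[w [w0 w1 ez]] [w' [w'0 w'1 ez']]].
have e := uK V W w w' VK WK w0 w'0 w1 w'1 (etrans (esym ez) ez').
have E (E : lmodType R) (F : space -> E) :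
    \sum_(v <- V) w v *: F v = \sum_(v <- (V `&` W)%fset) w v *: F v.
  rewrite (bigID (fun v => v \in W)) /= [X in _ + X]big1_seq ?addr0.
    rewrite -big_filter; apply: perm_big.
    apply: uniq_perm; rewrite ?filter_uniq ?fset_uniq // => v.
    by rewrite mem_filter !inE andbC.
  by move=> v /andP[vW vV]; have := e v; rewrite vV (negbTE vW) => ->; rewrite scale0r.
exists w; split.
- by move=> v; rewrite inE => /andP[/w0].
- have := E R^o (fun=> 1); rewrite /GRing.scale /=.
  under eq_bigr do rewrite mulr1; under [X in _ = X -> _]eq_bigr do rewrite mulr1.
  by rewrite w1.
- by rewrite -E.
Qed.

Lemma unique_weights_complex K :
  (forall V, V \in K -> V != fset0) ->
  (forall V W, V \in K -> W != fset0 -> (W `<=` V)%fset -> W \in K) ->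
  unique_weights K -> simplicial_complex K.
Proof.
move=> K0 Ksub uK; split => //.
  by move=> V VK; split; [exact: K0|exact: unique_weights_affinely_independent uK VK].
move=> V W VK WK; rewrite (unique_weights_hullI uK VK WK) => -[z [w [_ w1 _]]].
have ne : (V `&` W)%fset != fset0.
  apply/eqP => e; move: w1; rewrite e big_seq_fset0 => /eqP.
  by rewrite eq_sym oner_eq0.
split; exists (V `&` W)%fset; split => //; [exact: fsubsetIl|exact: fsubsetIr].
Qed.

End UniqueWeights.

Section LevelComplex.
Variables (R : realType) (d : nat) (h : vertex d -> R) (A : {fset vertex d}).
Local Notation space := 'rV[R]_d.
Hypothesis h_neq0 : forall v, h v != 0.
Hypothesis h_pos : forall v, 0 < h v -> v \in A.
Implicit Types (p q : vertex d * vertex d) (P Q : {fset vertex d * vertex d}).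

(** A finite set containing every edge pair, from which the staircases can be selected: the first
    vertex lies in [A] and the difference of the two has entries in {-1, 0, 1}, coded by ['I_3]
    shifted by 1. *)
Let candidates : {fset vertex d * vertex d} :=
  [fset (a, (a + \row_i ((s i : nat)%:Z - 1))%R) | a : vertex d in A,
    s : {ffun 'I_d -> 'I_3} in enum {: {ffun 'I_d -> 'I_3}}]%fset.

Let edge_pair_candidate p : edge_pair h p -> p \in candidates.
Proof.
case: p => a b /and3P[/= ha _ /andP[_ /forallP hk]].
apply/imfset2P; exists a; first exact: h_pos.
exists [ffun i => inord (absz (b ord0 i - a ord0 i + 1))]; first by rewrite /= mem_enum.
congr pair; apply: row_ord0P => i; rewrite !mxE ffunE.
have := hk i; rewrite ler_norml => /andP[k1 k2].
have e : (absz (b ord0 i - a ord0 i + 1) : int) = b ord0 i - a ord0 i + 1.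
  by rewrite gez0_abs //; lia.
by rewrite inordK ?e; [ring|rewrite -ltz_nat e; lia].
Qed.

Definition level_simplices : {fset {fset space}} :=
  [fset [fset crossing h p | p in (P : {fset vertex d * vertex d})]%fset
     | P in fpowerset candidates & `[< staircase h P >] && (P != fset0)]%fset.

Lemma level_simplicesP V : reflect (exists P,
  [/\ staircase h P, P != fset0 & V = [fset crossing h p | p in P]%fset])
  (V \in level_simplices).
Proof.
rewrite /level_simplices; apply: (iffP (imfsetP _ _ _ _)) => [[P /=]|[P [sP P0 ->]]].
  by rewrite inE /= => /andP[_ /andP[/asboolP ? ?]] ->; exists P.
exists P => //; rewrite inE /= P0 andbT; apply/andP; split; last exact/asboolP.
by rewrite fpowersetE; apply/fsubsetP => p /sP.1 /edge_pair_candidate.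
Qed.

(** The singletons of [p] and of [q] are staircases, so [staircase_unique] applies to the common
    point. *)
Lemma crossing_inj p q : edge_pair h p -> edge_pair h q -> crossing h p = crossing h q -> p = q.
Proof.
move=> ep eq e.
have st r : edge_pair h r -> staircase h [fset r]%fset.
  move=> er; have /and3P[_ _ k] := er; split; first by move=> s /fset1P ->.
  move=> s t /fset1P -> /fset1P ->; split; rewrite ?kuhn_refl //.
  by apply/orP; left; apply/andP; split; apply/vleP.
have m0 r : edge_pair h r -> 0 < (ray_mass h r)^-1 by move=> er; rewrite invr_gt0 ray_mass_gt0.
have := @staircase_unique _ _ h h_neq0 [fset p]%fset [fset q]%fset
  (fun p => (ray_mass h p)^-1) (fun p => (ray_mass h p)^-1) (st _ ep) (st _ eq).
rewrite !big_seq_fset1 !mulVf ?gt_eqF ?ray_mass_gt0 //.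
move=> /(_ _ _ erefl erefl e p); rewrite fset11 => H.
have {}H : (ray_mass h p)^-1 = (if p \in [fset q]%fset then (ray_mass h p)^-1 else 0).
  by apply: H => r /fset1P ->; exact/ltW/m0.
by move: H; case: ifP => [/fset1P //|_ H]; have := m0 _ ep; rewrite H ltxx.
Qed.

Lemma sum_crossing (E : lmodType R) (F : space -> E) P : staircase h P ->
  \sum_(v <- [fset crossing h p | p in P]%fset) F v = \sum_(p <- P) F (crossing h p).
Proof.
move=> [eP _]; rewrite big_imfset //= => p q pP qP; apply: crossing_inj; exact: eP.
Qed.

Lemma mem_crossing P p : staircase h P -> edge_pair h p ->
  (crossing h p \in [fset crossing h p | p in P]%fset) = (p \in P).
Proof.
move=> [eP _] ep; apply/imfsetP/idP => [[q qP /crossing_inj -> //]|pP]; first exact: eP.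
by exists p.
Qed.

Lemma weights_crossing P (w : space -> R) : staircase h P ->
  let g p := w (crossing h p) / ray_mass h p in
  \sum_(v <- [fset crossing h p | p in P]%fset) w v = \sum_(p <- P) g p * ray_mass h p /\
  \sum_(v <- [fset crossing h p | p in P]%fset) w v *: v = \sum_(p <- P) g p *: ray h p.
Proof.
move=> sP g; split.
  rewrite (sum_crossing (w : space -> R^o) sP) big_seq [RHS]big_seq.
  by apply: eq_bigr => p /sP.1 /ray_mass_gt0 k0; rewrite /g divfK // gt_eqF.
rewrite (sum_crossing _ sP); apply: eq_bigr => p _.
by rewrite /crossing scalerA.
Qed.

Lemma level_unique_weights : unique_weights level_simplices.
Proof.
move=> V W w w' /level_simplicesP[P [sP P0 ->]] /level_simplicesP[Q [sQ Q0 ->]] w0 w'0.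
have [-> ->] := weights_crossing w sP; have [-> ->] := weights_crossing w' sQ.
move=> w1 w'1 e.
have g0 p : p \in P -> 0 <= w (crossing h p) / ray_mass h p.
  move=> pP; rewrite divr_ge0 ?(ltW (ray_mass_gt0 (sP.1 _ pP))) // w0 //.
  by rewrite mem_crossing // sP.1.
have g'0 p : p \in Q -> 0 <= w' (crossing h p) / ray_mass h p.
  move=> pP; rewrite divr_ge0 ?(ltW (ray_mass_gt0 (sQ.1 _ pP))) // w'0 //.
  by rewrite mem_crossing // sQ.1.
have u := staircase_unique h_neq0 sP sQ g0 g'0 w1 w'1 e.
have conv p : edge_pair h p ->
    (if crossing h p \in [fset crossing h p | p in P]%fset then w (crossing h p) else 0) =
    (if crossing h p \in [fset crossing h p | p in Q]%fset then w' (crossing h p) else 0).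
  move=> ep; rewrite !mem_crossing //.
  have k0 : (ray_mass h p)^-1 != 0 by rewrite invr_neq0 // gt_eqF // ray_mass_gt0.
  have := u p; case: ifP => _; case: ifP => _ //; first exact: mulIf.
    by rewrite -[RHS](mul0r (ray_mass h p)^-1); exact: mulIf.
  by rewrite -[LHS](mul0r (ray_mass h p)^-1); exact: mulIf.
move=> x; have [/imfsetP[p /= pP ->]|xP] := boolP (x \in [fset crossing h p | p in P]%fset).
  by have := conv p (sP.1 _ pP); rewrite mem_crossing ?pP // sP.1.
case: ifP => // /imfsetP[q /= qQ xq].
have := conv q (sQ.1 _ qQ); rewrite -xq (negbTE xP).
by rewrite xq mem_crossing ?qQ // sQ.1.
Qed.

Lemma level_complex : simplicial_complex level_simplices.
Proof.
apply: unique_weights_complex; last exact: level_unique_weights.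
  move=> V /level_simplicesP[P [sP /fset0Pn[p pP] ->]].
  by apply/fset0Pn; exists (crossing h p); apply/imfsetP; exists p.
move=> V W /level_simplicesP[P [sP P0 ->]] /fset0Pn[x xW] /fsubsetP WV.
apply/level_simplicesP; exists [fset p in P | crossing h p \in W]%fset; split.
- by apply: staircase_sub sP; apply/fsubsetP => p; rewrite !inE => /andP[].
- have /imfsetP[p /= pP xp] := WV _ xW.
  by apply/fset0Pn; exists p; rewrite !inE pP -xp.
- apply/fsetP => y; apply/idP/imfsetP => [yW|[p /=]].
    have /imfsetP[p /= pP yp] := WV _ yW.
    by exists p => //=; rewrite !inE pP -yp.
  by rewrite !inE => /andP[_ ?] ->.
Qed.

Variable lambda : space -> R.
Hypothesis lambda_barycenter : forall V w, kuhn_chain V ->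
  (forall v, v \in V -> 0 <= w v) -> \sum_(v <- V) w v = 1 ->
  lambda (barycenter V w) = \sum_(v <- V) w v * h v.

Lemma level_underlying : [set z | lambda z = 0] = underlying_set level_simplices.
Proof.
apply/seteqP; split => z; last first.
  move=> [V /= /level_simplicesP[P [sP P0 ->]] [w [w0]]].
  pose g p := w (crossing h p) / ray_mass h p.
  have [sE1 sE2] := weights_crossing w sP; rewrite -/g in sE1 sE2.
  rewrite sE1 sE2 => w1 -> /=.
  have g0 p : p \in P -> 0 <= g p.
    move=> pP; rewrite divr_ge0 ?(ltW (ray_mass_gt0 (sP.1 _ pP))) // w0 //.
    by rewrite mem_crossing // sP.1.
  rewrite /ray -(@sum_ends _ _ h _ (@lattice_point R d)) lambda_barycenter.
  - have := @sum_ends _ _ h R^o h P g; rewrite /GRing.scale /= => ->.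
    by rewrite big1 // => p _; rewrite !mulVf // subrr mulr0.
  - exact: staircase_ends sP.
  - by move=> v _; exact: end_weight_ge0.
  - exact: sum_end_weight.
move=> /= z0; have [V [w [chV w0 w1 zE]]] := kuhn_decomposition z.
(* The staircase decomposition asks for positive weights, so vertices of weight 0 are dropped
   first. *)
pose V' := [fset v in V | 0 < w v]%fset.
have sumE (E : lmodType R) (F : vertex d -> E) :
    \sum_(v <- V) w v *: F v = \sum_(v <- V') w v *: F v.
  rewrite (bigID (fun v => 0 < w v)) /= [X in _ + X]big1_seq ?addr0.
    rewrite -big_filter; apply: perm_big.
    apply: uniq_perm; rewrite ?filter_uniq ?fset_uniq // => v.
    by rewrite mem_filter !inE andbC.
  move=> v /andP[nv vV]; suff -> : w v = 0 by rewrite scale0r.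
  by apply/eqP; rewrite eq_le w0 // leNgt nv.
have [|||P [g [sP PV g0 gE]]] := @staircase_decomposition R d h h_neq0 V' w.
- by move=> x y; rewrite !inE => /andP[xV _] /andP[yV _]; exact: chV.
- by move=> v; rewrite !inE => /andP[].
- have := sumE R^o h; rewrite /GRing.scale /= => <-.
  by rewrite -lambda_barycenter // -zE.
have g1 : \sum_(p <- P) g p * ray_mass h p = 1.
  have := gE R^o (fun=> 1); rewrite -sumE /GRing.scale /=.
  under eq_bigr do rewrite mulr1; rewrite w1 => ->.
  by apply: eq_bigr => p _; rewrite !mulr1.
have P0 : P != fset0.
  apply/eqP => e; move: g1; rewrite e big_seq_fset0 => /eqP.
  by rewrite eq_sym oner_eq0.
exists [fset crossing h p | p in P]%fset; first by apply/level_simplicesP; exists P.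
(* Weights must be indexed by points instead of pairs. Summing over the preimage avoids naming an
   inverse of [crossing]; by injectivity the sum has a single term at each crossing point. *)
pose w' x := \sum_(p <- P | crossing h p == x) g p * ray_mass h p.
have w'E p : p \in P -> w' (crossing h p) = g p * ray_mass h p.
  move=> pP; rewrite /w' big_mkcond (bigD1_seq p) ?fset_uniq //= eqxx big1_seq ?addr0 //.
  move=> q /andP[qp qP]; case: eqP => // e; move: qp.
  by rewrite (crossing_inj (sP.1 _ qP) (sP.1 _ pP) e) eqxx.
exists w'; split.
- move=> v _; rewrite /w' big_seq_cond sumr_ge0 // => p /andP[pP _].
  by rewrite mulr_ge0 // ltW ?g0 // ray_mass_gt0 // sP.1.
- rewrite (sum_crossing (w' : space -> R^o) sP) -g1 big_seq [RHS]big_seq.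
  by apply: eq_bigr => p /w'E.
- rewrite (sum_crossing _ sP) zE /barycenter sumE gE big_seq [RHS]big_seq.
  apply: eq_bigr => p pP; rewrite w'E // /crossing scalerA mulfK //.
  by rewrite gt_eqF // ray_mass_gt0 // sP.1.
Qed.

End LevelComplex.

(** * A sphere as a level set *)

Section RowTopology.
Variable R : realType.

Lemma continuous_row (T : topologicalType) n (f : T -> 'rV[R]_n) :
  (forall i, continuous (fun x => f x ord0 i)) -> continuous f.
Proof.
move=> cf x s [P /= nP sP]; apply: (filterS sP).
apply: filter_forall => i; apply: filter_forall => j.
by have := cf j x; rewrite (ord1 i); apply; have := nP 0 j.
Qed.

Lemma coord_le_norm n (x : 'rV[R]_n) i : `|x ord0 i| <= `|x|.
Proof.
rewrite [leRHS]/Num.norm /= mx_normrE.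
by apply: (le_bigmax _ (fun ij : 'I_1 * 'I_n => `|x ij.1 ij.2|) (ord0, i)).
Qed.

Lemma norm_row_le n (x : 'rV[R]_n) (M : R) : 0 <= M ->
  (forall i, `|x ord0 i| <= M) -> `|x| <= M.
Proof.
move=> M0 h; rewrite [leLHS]/Num.norm /= mx_normrE.
by apply: bigmax_le => // -[i j] _ /=; rewrite (ord1 i); exact: h.
Qed.

Lemma bounded_setP n (A : set 'rV[R]_n) :
  bounded_set A <-> exists M : R, forall x, A x -> forall i, `|x ord0 i| <= M.
Proof.
split=> [[M [Mr AM]]|[M AM]].
  exists (M + 1) => x Ax i; apply: le_trans (coord_le_norm x i) _.
  by apply: AM => //; rewrite ltrDl.
exists `|M|; split; first exact: normr_real.
move=> N MN x Ax /=; apply: norm_row_le.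
  by rewrite (le_trans _ (ltW MN)) ?normr_ge0.
move=> i; apply: le_trans (AM _ Ax i) _.
by rewrite (le_trans (ler_norm M)) // ltW.
Qed.

(** The preimage under [g] of a closed set is the image under [f] of a compact one, hence closed.
    Continuity of the inverse chart is thus obtained on the sphere only, where it suffices. *)
Lemma compact_inverse_continuous (T U : topologicalType) (K : set T)
    (f : T -> U) (g : U -> T) : hausdorff_space U -> compact K -> continuous f ->
  {in K, cancel f g} -> {within f @` K, continuous g}.
Proof.
move=> hU cK cf fK; apply/continuous_closedP => C clC.
apply/closed_subspaceP; exists (f @` (K `&` C)).
  apply: compact_closed => //; apply: continuous_compact.
    exact: continuous_subspaceT.
  exact: compact_closedI.
apply/seteqP; split=> [y [[x [Kx Cx] <-] fKx]|y [/= Cy [x Kx e]]].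
  split; last by exists x.
  by change (C (g (f x))); rewrite fK // inE.
split; last by exists x.
by exists x => //; split => //; rewrite -(fK x) ?inE // e.
Qed.

End RowTopology.

Section LevelFunction.
Variables (R : realType) (d : nat) (A : {fset vertex d}).
Local Notation space := 'rV[R]_d.
Local Notation lp := (lattice_point R).
Implicit Types (z : space) (v : vertex d).

Hypothesis A0 : 0 \in A.
Hypothesis A_down : forall (x x' : vertex d) (k : 'I_d), x \in A ->
  (forall j : 'I_d, (j < k)%N -> x' ord0 j = x ord0 j) ->
  (forall j : 'I_d, (k < j)%N -> x ord0 j = 0) ->
  (forall j : 'I_d, (k < j)%N -> x' ord0 j = 0) ->
  (0 <= x' ord0 k <= x ord0 k) || (x ord0 k <= x' ord0 k <= 0) -> x' \in A.

Variable eps : R.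
Hypothesis eps_gt0 : 0 < eps.
Hypothesis eps_small : forall v, v \in A -> eps * l1 (lp v) < 1 / 2.

(* The interpolated indicator of [A] is only weakly decreasing in the modulus of the
   last nonzero coordinate; the l1 term makes it strictly so. *)
Definition potential z : R := hat_sum A z - eps * l1 z.

Definition excess v : R := (v \in A)%:R - eps * l1 (lp v) - 1 / 2.

Lemma l1_ge0 z : 0 <= l1 z.
Proof. by rewrite sumr_ge0. Qed.

Lemma excess_gt0 v : (0 < excess v) = (v \in A).
Proof.
rewrite /excess; case: (boolP (v \in A)) => [/eps_small|_] /=.
  by rewrite mulr1n => ?; apply/idP; lra.
rewrite mulr0n; apply/negbTE; rewrite -leNgt.
have := mulr_ge0 (ltW eps_gt0) (l1_ge0 (lp v)); lra.
Qed.

Lemma excess_neq0 v : excess v != 0.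
Proof.
have [vA|vA] := boolP (v \in A); first by rewrite gt_eqF // excess_gt0.
rewrite lt_eqF // /excess (negbTE vA) mulr0n.
have := mulr_ge0 (ltW eps_gt0) (l1_ge0 (lp v)); lra.
Qed.

Lemma level_barycenter V w : kuhn_chain V -> (forall v, v \in V -> 0 <= w v) ->
  \sum_(v <- V) w v = 1 ->
  potential (barycenter V w) - 1 / 2 = \sum_(v <- V) w v * excess v.
Proof.
move=> chV w0 w1; rewrite /potential hat_sum_barycenter // l1_barycenter //.
under [RHS]eq_bigr do rewrite !mulrBr.
rewrite !sumrB -mulr_suml w1 mul1r mulr_sumr; congr (_ - _ - _).
  by apply: eq_bigr => v _; rewrite mulrCA.
by rewrite mul1r.
Qed.

Lemma level_lattice v : potential (lp v) - 1 / 2 = excess v.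
Proof.
have := @level_barycenter [fset v]%fset (fun=> 1).
rewrite /barycenter !big_seq_fset1 scale1r [1 * excess _]mul1r; apply => //.
by move=> x y /fset1P -> /fset1P ->; exact: kuhn_refl.
Qed.

Lemma level0 : potential 0 = 1.
Proof.
have e : lp (0 : vertex d) = 0 by apply: row_ord0P => i; rewrite !mxE.
have := level_lattice 0; rewrite e /excess A0 e.
have -> : l1 (0 : space) = 0 by rewrite /l1 big1 // => i _; rewrite mxE normr0.
rewrite mulr1n mulr0; lra.
Qed.

Definition slice (k : 'I_d) z (t : R) : space :=
  \row_i (if (i < k)%N then z ord0 i else if i == k then t else 0).

Definition trunc (k : nat) z : space := \row_i (if (i < k)%N then z ord0 i else 0).

Lemma slice0 (k : 'I_d) z : slice k z 0 = trunc k z.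
Proof. by apply: row_ord0P => i; rewrite !mxE; case: ifP => // _; case: eqP. Qed.

Lemma slice_coord (k : 'I_d) z : slice k z (z ord0 k) = trunc k.+1 z.
Proof.
apply: row_ord0P => i; rewrite !mxE ltnS.
case: (ltngtP i k) => [//|ki|/val_inj ->]; last by rewrite eqxx.
by rewrite -val_eqE /= gtn_eqF.
Qed.

Lemma trunc_all z : trunc d z = z.
Proof. by apply: row_ord0P => i; rewrite !mxE ltn_ord. Qed.

Lemma trunc_none z : trunc 0 z = 0.
Proof. by apply: row_ord0P => i; rewrite !mxE. Qed.

Lemma l1_slice (k : 'I_d) z t : l1 (slice k z t) = l1 (trunc k z) + `|t|.
Proof.
rewrite /l1 (bigD1 k) //= [in RHS](bigD1 k) //= !mxE ltnn eqxx normr0 add0r addrC.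
congr (_ + _); apply: eq_bigr => i /negbTE ik; rewrite !mxE ik //.
Qed.

(** Shift both points by the same [th] in [0, 1[ and take floors: the coordinates before [k] agree,
    those after [k] are 0, and the [k]-th floor for [t] lies between 0 and the one for [t']. So
    [A_down] carries membership in [A] from the second vertex to the first. *)
Lemma hat_sum_slice_le (k : 'I_d) z (t t' : R) : (0 <= t <= t') || (t' <= t <= 0) ->
  hat_sum A (slice k z t') <= hat_sum A (slice k z t).
Proof.
move=> tt'; apply: le_hat_sum => v th vA [th01 hth].
pose v' : vertex d := \row_i Num.floor (slice k z t ord0 i + th).
exists v'; last exact: floor_cell_floor.
have vE i : v ord0 i = Num.floor (slice k z t' ord0 i + th).
  by apply/esym/floor_def; rewrite intrD1; exact: hth.
have f0 : Num.floor (0 + th) = 0.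
  by apply: floor_def; rewrite add0r intrD1 add0r.
apply: (A_down vA (k := k)) => [j jk|j jk|j jk|].
- by rewrite vE !mxE jk.
- by rewrite vE mxE ltnNge (ltnW jk) /= -val_eqE /= gtn_eqF.
- by rewrite !mxE ltnNge (ltnW jk) /= -val_eqE /= gtn_eqF.
rewrite vE !mxE ltnn eqxx; case/andP: th01 => th0 th1.
case/orP: tt' => /andP[h1 h2]; apply/orP; [left|right]; apply/andP; split.
- by rewrite floor_ge_int //; lra.
- by apply: le_floor; lra.
- by apply: le_floor; lra.
- by rewrite -ltzD1 add0r floor_lt_int //; lra.
Qed.

Lemma level_slice_lt (k : 'I_d) z (t t' : R) : (0 <= t <= t') || (t' <= t <= 0) ->
  potential (slice k z t') + eps * (`|t'| - `|t|) <= potential (slice k z t).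
Proof.
move=> tt'; have := hat_sum_slice_le k z tt'; rewrite /potential !l1_slice; lra.
Qed.

Lemma continuous_coord (i : 'I_d) : continuous (fun z : space => z ord0 i).
Proof. exact: coord_continuous. Qed.

Lemma continuous_peak : continuous (@peak R d).
Proof.
apply: (@continuous_big _ _ _ _ xpredT) => [|i _]; first exact: (@max_continuous _ R).
exact: continuous_coord.
Qed.

Lemma continuous_subr (T : topologicalType) (f g : T -> R) :
  continuous f -> continuous g -> continuous (fun x => f x - g x).
Proof. by move=> cf cg x; apply: cvgB; [exact: cf|exact: cg]. Qed.

Lemma continuous_maxr (T : topologicalType) (f g : T -> R) :
  continuous f -> continuous g -> continuous (fun x => Num.max (f x) (g x)).
Proof. exact: max_fun_continuous. Qed.

Lemma continuous_sumr (T : topologicalType) (I : Type) (r : seq I) (f : I -> T -> R) :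
  (forall i, continuous (f i)) -> continuous (fun x => \sum_(i <- r) f i x).
Proof.
move=> cf; apply: (@continuous_big _ _ _ _ xpredT) => [|i _]; last exact: cf.
exact: (@add_continuous R).
Qed.

Lemma continuous_cst (T : topologicalType) (c : R) : continuous (fun _ : T => c).
Proof. by move=> x; exact: cvg_cst. Qed.

Lemma continuous_hat v : continuous (@hat R d v).
Proof.
apply: continuous_maxr; first exact: continuous_cst.
apply: continuous_subr; first apply: continuous_subr; first exact: continuous_cst.
- move=> z; apply: continuous_comp; last exact: continuous_peak.
  by apply: continuous_row => i; under eq_fun do rewrite !mxE;
     apply: continuous_subr; [exact: continuous_coord|exact: continuous_cst].
- move=> z; apply: continuous_comp; last exact: continuous_peak.
  by apply: continuous_row => i; under eq_fun do rewrite !mxE;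
     apply: continuous_subr; [exact: continuous_cst|exact: continuous_coord].
Qed.

Lemma continuous_l1 : continuous (@l1 R d).
Proof.
apply: continuous_sumr => i z; apply: (@continuous_comp _ _ _ (fun z : space => z ord0 i)).
  exact: continuous_coord.
exact: norm_continuous.
Qed.

Lemma continuous_level : continuous potential.
Proof.
apply: continuous_subr; first by apply: continuous_sumr => v; exact: continuous_hat.
by move=> z; apply: continuousM; [exact: continuous_cst|exact: continuous_l1].
Qed.

Lemma continuous_slice (T : topologicalType) k (f : T -> space) (t : T -> R) :
  continuous f -> continuous t -> continuous (fun x => slice k (f x) (t x)).
Proof.
move=> cf ct; apply: continuous_row => i; under eq_fun do rewrite mxE.
case: (i < k)%N; last by case: (i == k) => //; exact: continuous_cst.
move=> x; apply: (@continuous_comp _ _ _ f (fun z : space => z ord0 i)); first exact: cf.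
exact: continuous_coord.
Qed.

Lemma continuous_trunc k : continuous (trunc k).
Proof.
apply: continuous_row => i; under eq_fun do rewrite mxE.
by case: (i < k)%N; [exact: continuous_coord|exact: continuous_cst].
Qed.

Definition descent (i : 'I_d) z (t : R) : R := potential (trunc i z) - potential (slice i z t).

Lemma descent0 i z : descent i z 0 = 0.
Proof. by rewrite /descent slice0 subrr. Qed.

(** The contribution of the l1 term. It makes the descent vanish only at [t = 0], and the linear
    growth supplies the endpoints for the intermediate value theorem in [descent_surj]. *)
Lemma descent_lower i z t : eps * `|t| <= descent i z t.
Proof.
have := @level_slice_lt i z 0 t; rewrite slice0 normr0 subr0 /descent !lexx /= ?andbT.
by rewrite le_total => /(_ isT); lra.
Qed.

Lemma descent_ge0 i z t : 0 <= descent i z t.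
Proof. by rewrite (le_trans _ (descent_lower i z t)) // mulr_ge0 // ltW. Qed.

Lemma descent_inj i z t t' : 0 <= t * t' -> descent i z t = descent i z t' -> t = t'.
Proof.
move=> tt'; rewrite /descent => /addrI /oppr_inj e.
wlog le : t t' tt' e / `|t| <= `|t'|.
  move=> H; have [/H|/ltW/H] := leP `|t| `|t'|; first exact.
  by rewrite mulrC => /(_ tt' (esym e)).
have sg : (0 <= t <= t') || (t' <= t <= 0).
  move: le; have [t0|t0] := leP 0 t; have [t'0|t'0] := leP 0 t'.
  - by rewrite !ger0_norm // => ->.
  - have -> : t = 0 by apply/eqP; rewrite eq_le t0 andbT -(nmulr_lge0 _ t'0).
    by rewrite lexx (ltW t'0) orbT.
  - have -> : t' = 0 by apply/eqP; rewrite eq_le t'0 andbT -(nmulr_rge0 _ t0).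
    by rewrite normr0 normr_le0 => /eqP t00; rewrite t00 ltxx in t0.
  - by rewrite !ltr0_norm // lerN2 => ->; rewrite (ltW t0) orbT.
have := level_slice_lt i z sg; rewrite -e -[leRHS]addr0 lerD2l pmulr_rle0 // subr_le0 => ge.
have {le ge} : `|t| = `|t'| by apply/eqP; rewrite eq_le le.
case/orP: sg => /andP[h1 h2].
  by rewrite !ger0_norm //; apply: le_trans h2.
by rewrite !ler0_norm // => [/oppr_inj//|]; apply: le_trans h2.
Qed.

(* A signed square root of [descent i z (z ord0 i)], in a visibly continuous form. *)
Definition chart z : space :=
  \row_i (Num.sqrt (descent i z (Num.max (z ord0 i) 0)) -
          Num.sqrt (descent i z (Num.min (z ord0 i) 0))).

Lemma chart_pos z (i : 'I_d) : 0 <= z ord0 i ->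
  chart z ord0 i = Num.sqrt (descent i z (z ord0 i)).
Proof. by move=> z0; rewrite mxE max_l // min_r // descent0 sqrtr0 subr0. Qed.

Lemma chart_neg z (i : 'I_d) : z ord0 i <= 0 ->
  chart z ord0 i = - Num.sqrt (descent i z (z ord0 i)).
Proof. by move=> z0; rewrite mxE max_r // min_l // descent0 sqrtr0 sub0r. Qed.

Lemma chart_sqr z (i : 'I_d) :
  chart z ord0 i ^+ 2 = potential (trunc i z) - potential (trunc i.+1 z).
Proof.
have -> : chart z ord0 i ^+ 2 = descent i z (z ord0 i).
  by case: (leP 0 (z ord0 i)) => [/chart_pos|/ltW/chart_neg] ->;
    rewrite ?sqrrN sqr_sqrtr ?descent_ge0.
by rewrite /descent slice_coord.
Qed.

Lemma chart_norm z : \sum_i chart z ord0 i ^+ 2 = 1 - potential z.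
Proof.
under eq_bigr do rewrite chart_sqr.
rewrite -(big_mkord xpredT (fun i => potential (trunc i z) - potential (trunc i.+1 z))).
rewrite (@telescope_sumr_eq _ _ _ (fun i => - potential (trunc i z))) // => [|i _].
  by rewrite trunc_none trunc_all level0 opprK addrC.
by rewrite opprK addrC.
Qed.

Lemma continuous_chart : continuous chart.
Proof.
have csqrt (T : topologicalType) (f : T -> R) :
    continuous f -> continuous (fun x => Num.sqrt (f x)).
  move=> cf x; apply: (@continuous_comp _ _ _ f Num.sqrt); first exact: cf.
  exact: sqrt_continuous.
have cdescent (i : 'I_d) (t : space -> R) : continuous t -> continuous (fun z => descent i z (t z)).
  move=> ct; apply: continuous_subr => z.
    apply: (@continuous_comp _ _ _ (trunc i) potential); first exact: continuous_trunc.
    exact: continuous_level.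
  apply: (@continuous_comp _ _ _ (fun z => slice i z (t z)) potential).
    by apply: (@continuous_slice space i (fun z => z) t _ ct) => x; exact: cvg_id.
  exact: continuous_level.
apply: continuous_row => i; under eq_fun do rewrite mxE.
apply: continuous_subr; apply: csqrt; apply: cdescent.
  apply: continuous_maxr; [exact: continuous_coord|exact: continuous_cst].
apply: min_fun_continuous; [exact: continuous_coord|exact: continuous_cst].
Qed.

Lemma trunc_eq z z' k : (k <= d)%N ->
  trunc k z = trunc k z' <-> forall i : 'I_d, (i < k)%N -> z ord0 i = z' ord0 i.
Proof.
move=> kd; split=> [e i ik|h]; last first.
  by apply: row_ord0P => i; rewrite !mxE; case: ifP => // /h.
by have := congr1 (fun x : space => x ord0 i) e; rewrite !mxE ik.
Qed.

Lemma descent_trunc (i : 'I_d) z z' t : trunc i z = trunc i z' -> descent i z t = descent i z' t.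
Proof.
move=> e; rewrite /descent e; congr (_ - potential _).
apply: row_ord0P => j; rewrite !mxE; case: ifP => // ji.
by have /(trunc_eq _ _ (ltnW (ltn_ord i))) := e; apply.
Qed.

(** The chart is triangular: its coordinate [i] depends only on the coordinates of [z] up to [i]. So
    the coordinates are recovered one at a time. *)
Lemma chart_inj : injective chart.
Proof.
move=> z z' e; rewrite -(trunc_all z) -(trunc_all z').
suff H k : (k <= d)%N -> trunc k z = trunc k z' by exact: H.
elim: k => [|k IH] kd; first by rewrite !trunc_none.
have {IH}/(_ (ltnW kd)) IH := IH.
pose i : 'I_d := Ordinal kd.
apply/(trunc_eq _ _ kd) => j; rewrite ltnS leq_eqVlt => /orP[/eqP jk|jk]; last first.
  by have /(trunc_eq _ _ (ltnW kd)) := IH; apply.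
have {j jk} -> : j = i by apply/val_inj.
have ei : chart z ord0 i = chart z' ord0 i by rewrite e.
have edescent t : descent i z t = descent i z' t by exact: descent_trunc.
have sq x : eps * `|x| <= Num.sqrt (descent i z x) ^+ 2.
  by rewrite sqr_sqrtr ?descent_ge0 // descent_lower.
have sq0 x : Num.sqrt (descent i z x) = 0 -> x = 0.
  move=> s0; have := sq x; rewrite s0 expr0n /= pmulr_rle0 // normr_le0.
  by move/eqP.
have sinj t t' : 0 <= t * t' -> Num.sqrt (descent i z t) = Num.sqrt (descent i z t') -> t = t'.
  move=> tt' /(congr1 (fun x => x ^+ 2)); rewrite !sqr_sqrtr ?descent_ge0 //.
  exact: descent_inj.
have s0 x : 0 <= Num.sqrt (descent i z x) by exact: sqrtr_ge0.
(* For coordinates of opposite signs, equal chart values force both square roots to vanish, hence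
   both coordinates. *)
have opp (x y : R) : 0 <= x -> 0 <= y -> x = - y -> x = 0 /\ y = 0.
  by move=> x0 y0 xy; split; apply/eqP; rewrite eq_le ?x0 ?y0 andbT; lra.
have [z0|/ltW z0] := leP 0 (z ord0 i); have [z'0|/ltW z'0] := leP 0 (z' ord0 i).
- move: ei; rewrite !chart_pos // -edescent; apply: sinj; exact: mulr_ge0.
- move: ei; rewrite chart_pos // chart_neg // -edescent => ei.
  by have [/sq0 -> /sq0 ->] := opp _ _ (s0 _) (s0 _) ei.
- move: ei; rewrite chart_neg // chart_pos // -edescent => /esym ei.
  by have [/sq0 -> /sq0 ->] := opp _ _ (s0 _) (s0 _) ei.
- move: ei; rewrite !chart_neg // -edescent => /oppr_inj; apply: sinj; exact: mulr_le0.
Qed.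

Lemma descent_surj (i : 'I_d) z (s : R) : 0 <= s ->
  (exists2 t, 0 <= t & descent i z t = s) /\ (exists2 t, t <= 0 & descent i z t = s).
Proof.
(* By [descent_lower], the descent at distance [b] from 0 is at least [eps * b = s]. *)
move=> s0; pose b := s / eps.
have b0 : 0 <= b by rewrite divr_ge0 // ltW.
have cd : continuous (fun t => descent i z t).
  apply: continuous_subr; first exact: continuous_cst.
  move=> t; apply: (@continuous_comp _ _ _ (fun t => slice i z t) potential).
    by apply: (@continuous_slice R i (fun=> z) (fun t => t)) => x; [exact: cvg_cst|exact: cvg_id].
  exact: continuous_level.
have big x : `|x| = b -> s <= descent i z x.
  move=> xb; apply: le_trans (descent_lower i z x).
  by rewrite xb /b mulrC divfK // gt_eqF.
split.
  have [||t] := @IVT _ (fun t => descent i z t) 0 b s b0.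
  - exact: continuous_subspaceT.
  - by rewrite descent0 min_l ?max_r ?descent_ge0 // s0 big // ger0_norm.
  by rewrite in_itv /= => /andP[t0 _] e; exists t.
have [|||t] := @IVT _ (fun t => descent i z t) (- b) 0 s.
- by rewrite oppr_le0.
- exact: continuous_subspaceT.
- by rewrite descent0 min_r ?max_l ?descent_ge0 // s0 big // normrN ger0_norm.
by rewrite in_itv /= => /andP[_ t0] e; exists t.
Qed.

(** The triangular system is solved coordinate by coordinate: [slice] adjusts coordinate [k] without
    touching the earlier ones, and the sign of [u] selects the positive or the negative solution of
    [descent_surj]. *)
Lemma chart_surj (u : space) : exists z, chart z = u.
Proof.
suff H k : (k <= d)%N ->
    exists z, forall i : 'I_d, (i < k)%N -> chart z ord0 i = u ord0 i.
  by have [z hz] := H d (leqnn d); exists z; apply: row_ord0P => i; exact: hz.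
elim: k => [|k IH] kd; first by exists 0.
have [z hz] := IH (ltnW kd); pose i : 'I_d := Ordinal kd.
have [[t t0 et] [t' t'0 et']] := @descent_surj i z (u ord0 i ^+ 2) (sqr_ge0 _).
pose a := if 0 <= u ord0 i then t else t'; pose z' := slice i z a.
have z'E (j : 'I_d) : (j < k)%N -> z' ord0 j = z ord0 j by move=> jk; rewrite mxE jk.
have tr (j : 'I_d) : (j <= k)%N -> trunc j z' = trunc j z.
  move=> jk; apply/(trunc_eq _ _ (ltnW (ltn_ord j))) => l lj; apply: z'E.
  exact: leq_trans jk.
have z'i : z' ord0 i = a by rewrite mxE ltnn eqxx.
exists z' => j; rewrite ltnS leq_eqVlt => /orP[/eqP jk|jk]; last first.
  by rewrite -hz // [LHS]mxE [RHS]mxE z'E // !(descent_trunc _ (tr _ (ltnW jk))).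
have -> : j = i by apply/val_inj.
have dE x : descent i z' x = descent i z x by apply: descent_trunc; apply: tr.
rewrite /a in z'i; move: z'i; case: leP => [u0|/ltW u0] z'i.
  by rewrite chart_pos z'i // dE et sqrtr_sqr ger0_norm.
by rewrite chart_neg z'i // dE et' sqrtr_sqr ler0_norm ?opprK.
Qed.

End LevelFunction.

Section Neighbours.
Variable d : nat.
Implicit Types x y : vertex d.

Lemma neighboursC x y : neighbours x y = neighbours y x.
Proof.
rewrite /neighbours; congr (_ == _); apply: eq_bigr => i _.
by rewrite -sqrrN opprB.
Qed.

Lemma neighbours_neq x y : neighbours x y -> x != y.
Proof.
apply: contraTneq => ->; rewrite /neighbours big1 // => i _.
by rewrite subrr expr0n.
Qed.

(** Incomparable vertices differ in two coordinates, so their squared distance is at least 2. As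
    bonds are edges of the triangulation, the potential is affine along each of them. *)
Lemma neighbours_kuhn x y : neighbours x y -> kuhn x y.
Proof.
move=> /eqP nxy; have sq0 i : 0 <= (x ord0 i - y ord0 i) ^+ 2 by exact: sqr_ge0.
have sq1 i j : i != j -> (x ord0 i - y ord0 i) ^+ 2 + (x ord0 j - y ord0 j) ^+ 2 <= 1.
  move=> ij; rewrite -nxy (bigD1 i) //= lerD2l (bigD1 j) 1?eq_sym //= lerDl.
  by rewrite sumr_ge0.
have sq_pos i : x ord0 i != y ord0 i -> 1 <= (x ord0 i - y ord0 i) ^+ 2.
  by move=> ne; rewrite -gtz0_ge1 exprn_even_gt0 //= subr_eq0.
apply/andP; split; last first.
  apply/forallP => i; rewrite -(@expr_le1 _ 2) // -normrX ger0_norm // -nxy.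
  by rewrite (bigD1 i) //= lerDl sumr_ge0.
apply/negPn/negP; rewrite negb_or => /andP[/forallPn[i] + /forallPn[j]].
rewrite -!ltNge => yx xy; have ij : i != j by apply: contraTneq yx => ->; rewrite -leNgt ltW.
have := sq1 _ _ ij; have := sq_pos i; have := sq_pos j.
by rewrite (lt_eqF xy) (gt_eqF yx) => /(_ isT) + /(_ isT); lia.
Qed.

Lemma edge_neighbours (e : edge d) x y : val e = [fset x; y]%fset -> neighbours x y.
Proof.
have /asboolP[x' [y' [n ->]]] := valP e => /fsetP E.
have := E x'; rewrite !inE eqxx /= => /esym /orP[] /eqP ex.
  have := E y; rewrite !inE eqxx orbT => /orP[] /eqP ey; last by rewrite -ex ey.
  have := E y'; rewrite !inE eqxx orbT -ex -ey => /esym.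
  by rewrite ey orbb => /eqP yx; move: (neighbours_neq n); rewrite yx eqxx.
have := E x; rewrite !inE eqxx /= => /orP[] /eqP ey; last first.
  by rewrite neighboursC ey -ex.
have := E y'; rewrite !inE eqxx orbT -ex ey => /esym.
by rewrite orbb => /eqP yx; move: (neighbours_neq n); rewrite yx eqxx.
Qed.

End Neighbours.

Section LevelSphere.
Variables (R : realType) (d : nat) (A : {fset vertex d}).
Local Notation space := 'rV[R]_d.
Local Notation lp := (lattice_point R).
Implicit Types (z : space) (v : vertex d).

Hypothesis A0 : 0 \in A.
Hypothesis A_down : forall (x x' : vertex d) (k : 'I_d), x \in A ->
  (forall j : 'I_d, (j < k)%N -> x' ord0 j = x ord0 j) ->
  (forall j : 'I_d, (k < j)%N -> x ord0 j = 0) ->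
  (forall j : 'I_d, (k < j)%N -> x' ord0 j = 0) ->
  (0 <= x' ord0 k <= x ord0 k) || (x ord0 k <= x' ord0 k <= 0) -> x' \in A.

Variable eps : R.
Hypothesis eps_gt0 : 0 < eps.
Hypothesis eps_small : forall v, v \in A -> eps * l1 (lp v) < 1 / 2.

Local Notation level := (potential A eps).
Local Notation excess := (excess A eps).
Let S : set space := [set z | level z = 1 / 2].

Let coord_le_l1 z i : `|z ord0 i| <= l1 z.
Proof. by rewrite /l1 (bigD1 i) //= lerDl sumr_ge0. Qed.

Lemma superlevel_bounded z i : 1 / 2 <= level z -> `|z ord0 i| <= 1 / eps.
Proof.
move=> lz; apply: le_trans (coord_le_l1 z i) _; rewrite ler_pdivlMr //.
move: lz; rewrite /potential; have := hat_sum_le1 A z; lra.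
Qed.

Let compact_S : compact S.
Proof.
apply: bounded_closed_compact.
  by apply/bounded_setP; exists (1 / eps) => z Sz i; rewrite superlevel_bounded // Sz.
apply: (@preimage_closed _ _ level [set x | x = 1 / 2]).
  by move=> z _; exact: continuous_level.
exact: closed_eq.
Qed.

Let chart_norm_S z : (\sum_i chart A eps z ord0 i ^+ 2 == 1 / 2) = (level z == 1 / 2).
Proof. by rewrite chart_norm //; apply/eqP/eqP; lra. Qed.

Lemma level_homeomorphic : homeomorphic S (@unit_sphere R d).
Proof.
(* On [S] the squared norm of the chart is 1 - 1/2, so scaling by the square root of 2 lands on the
   unit sphere. *)
pose r : R := Num.sqrt 2.
have r2 : r ^+ 2 = 2 by rewrite sqr_sqrtr.
have r0 : r != 0 by rewrite sqrtr_eq0 -ltNge.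
have /choice[g0 g0P] := @chart_surj R d A A_down eps eps_gt0.
pose f z := r *: chart A eps z; pose g u := g0 (r^-1 *: u).
have fS z : S z <-> unit_sphere (f z).
  have -> : unit_sphere (f z) <-> \sum_i chart A eps z ord0 i ^+ 2 == 1 / 2.
    rewrite /unit_sphere /=; under eq_bigr do rewrite mxE exprMn r2.
    by rewrite -mulr_sumr; split => [h|/eqP ->]; [apply/eqP; lra|lra].
  by rewrite chart_norm_S; split=> /eqP.
have fg u : f (g u) = u by rewrite /f /g g0P scalerA mulfV // scale1r.
have gf z : g (f z) = z.
  apply: (@chart_inj R d A A_down eps eps_gt0).
  by rewrite /g g0P /f scalerA mulVf // scale1r.
have cf : continuous f.
  apply: continuous_row => i; under eq_fun do rewrite mxE.
  move=> z; apply: (@continuousM R space (fun=> r) (fun z => chart A eps z ord0 i)).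
    exact: continuous_cst.
  apply: (@continuous_comp _ _ _ (chart A eps) (fun z : space => z ord0 i)).
    exact: continuous_chart.
  exact: coord_continuous.
have fSE : f @` S = @unit_sphere R d.
  apply/seteqP; split=> [_ [z Sz <-]|u hu]; first exact/fS.
  by exists (g u) => //; apply/fS; rewrite fg.
exists f, g; split.
- exact: continuous_subspaceT.
- rewrite -fSE; apply: (compact_inverse_continuous _ compact_S) => //; exact: norm_hausdorff.
- by split=> [z /fS //|u hu]; apply/fS; rewrite fg.
- by move=> z _.
- by move=> u _.
Qed.

Lemma level_sphere : sphere S.
Proof.
split.
- exists (level_simplices excess A).
  have h0 := excess_neq0 eps_gt0 eps_small.
  have hp v : 0 < excess v -> v \in A by rewrite excess_gt0.
  split; first exact: level_complex.
  rewrite -(@level_underlying _ _ _ _ h0 hp (fun z => level z - 1 / 2)).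
    by apply/seteqP; split=> z /eqP; rewrite ?subr_eq0 => /eqP //= ->; rewrite ?subrr.
  by move=> *; exact: level_barycenter.
- exact: level_homeomorphic.
- rewrite -subset0 => _ [/[swap] [[v _ <-]] e].
  have := excess_neq0 eps_gt0 eps_small v; rewrite -level_lattice e.
  by rewrite subrr eqxx.
Qed.

(** The potential is 1 at the origin, and on a connected set avoiding [S] it cannot pass below 1/2.
    So the component of the origin lies in a superlevel set, which the l1 term makes bounded. *)
Lemma level_inside : inside S 0.
Proof.
have S0 : (~` S) 0 by rewrite /S /= level0 //; lra.
exists (connected_component (~` S) 0); last exact: connected_component_refl.
split; first by exists 0.
suff sub : connected_component (~` S) 0 `<=` [set z | 1 / 2 <= level z].
  by apply/bounded_setP; exists (1 / eps) => z /sub lz i; exact: superlevel_bounded.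
move=> z [C [C0 CS conC] Cz] /=; rewrite leNgt; apply/negP => lz.
have : connected (level @` C).
  apply: connected_continuous_connected => //.
  exact/continuous_subspaceT/continuous_level.
move=> /connected_intervalP /(_ (level z) 1) H.
have [y Cy ly] : (level @` C) (1 / 2).
  apply: H; [by exists z|by exists 0; rewrite ?level0|].
  by apply/andP; split; lra.
by apply: (CS _ Cy).
Qed.

(** Along the bond the potential minus 1/2 interpolates affinely between the excesses of the two
    ends. A zero is impossible when both are positive or both negative. *)
Lemma level_bond (e : edge d) : bond e `&` S !=set0 ->
  exists x y, [/\ val e = [fset x; y]%fset, x \in A & y \notin A].
Proof.
move=> [z [[x [y [t [eE /andP[t0 t1] zE]]]] Sz]].
have nxy := edge_neighbours eE; have xy := neighbours_neq nxy.
pose w v := if v == x then 1 - t else t.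
have sumE (E : lmodType R) (F : vertex d -> E) :
    \sum_(v <- [fset x; y]%fset) w v *: F v = (1 - t) *: F x + t *: F y.
  rewrite big_fsetU1 ?inE //= big_seq_fset1 /w eqxx eq_sym (negbTE xy) //.
have ch : kuhn_chain [fset x; y]%fset.
  move=> a b; rewrite !inE => /orP[] /eqP -> /orP[] /eqP ->; rewrite ?kuhn_refl //.
    exact: neighbours_kuhn.
  by rewrite kuhnC; exact: neighbours_kuhn.
have w0 v : v \in [fset x; y]%fset -> 0 <= w v.
  by move=> _; rewrite /w; case: eqP; rewrite // subr_ge0.
have w1 : \sum_(v <- [fset x; y]%fset) w v = 1.
  have := sumE R^o (fun=> 1); rewrite /GRing.scale /= !mulr1 subrK.
  by under eq_bigr do rewrite mulr1.
have := level_barycenter A eps ch w0 w1; rewrite /barycenter sumE -zE Sz subrr.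
have := sumE R^o excess; rewrite /GRing.scale /= => -> ex0.
have pos v : v \in A -> 0 < excess v by rewrite excess_gt0.
have neg v : v \notin A -> excess v < 0.
  by move=> vA; rewrite lt_neqAle excess_neq0 // leNgt excess_gt0.
have [xA|xA] := boolP (x \in A); have [yA|yA] := boolP (y \in A).
- have := pos _ xA; have := pos _ yA; nra.
- by exists x, y.
- by exists y, x; split => //; rewrite eE fsetUC.
- have := neg _ xA; have := neg _ yA; nra.
Qed.

(** The interpolated indicator is positive at [z], so some hat function of a vertex of [A] is too.
    That vertex differs from [z] by at most 1 in each of the [d] coordinates. *)
Lemma level_radius z : S z -> exists2 v, v \in A & l1 z <= l1 (lp v) + d%:R.
Proof.
move=> Sz; have hs : 0 < hat_sum A z.
  have := Sz; rewrite /S /= /potential.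
  have := mulr_ge0 (ltW eps_gt0) (l1_ge0 z); lra.
have [v vA hv] : exists2 v, v \in A & 0 < hat v z.
  apply: contrapT => no; move: hs; rewrite ltNge => /negP; apply.
  rewrite -oppr_ge0 /hat_sum -sumrN big_seq sumr_ge0 // => v vA.
  by rewrite oppr_ge0 leNgt; apply/negP => ?; apply: no; exists v.
have -> : d%:R = \sum_(i < d) (1 : R) by rewrite sumr_const card_ord.
exists v => //; rewrite /l1 -big_split /=.
apply: ler_sum => i _; move: hv; rewrite /hat lt_max ltxx /= => hv.
have p1 := le_peak (z - lp v) i; have p2 := le_peak (lp v - z) i.
have q1 := peak_ge0 (z - lp v); have q2 := peak_ge0 (lp v - z).
rewrite !mxE in p1 p2; rewrite mxE -lerBlDl.
apply: le_trans (lerB_dist _ _) _; rewrite ler_norml; apply/andP; split; lra.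
Qed.

End LevelSphere.

Lemma surrounding_sphere (R : realType) (d : nat) (A : {fset vertex d}) :
  0 \in A ->
  (forall (x x' : vertex d) (k : 'I_d), x \in A ->
    (forall j : 'I_d, (j < k)%N -> x' ord0 j = x ord0 j) ->
    (forall j : 'I_d, (k < j)%N -> x ord0 j = 0) ->
    (forall j : 'I_d, (k < j)%N -> x' ord0 j = 0) ->
    (0 <= x' ord0 k <= x ord0 k) || (x ord0 k <= x' ord0 k <= 0) -> x' \in A) ->
  exists S : set 'rV[R]_d,
    [/\ sphere S, inside S 0,
        forall e : edge d, bond e `&` S !=set0 ->
          exists x y, [/\ val e = [fset x; y]%fset, x \in A & y \notin A] &
        forall z, S z -> exists2 v, v \in A & l1 z <= l1 (lattice_point R v) + d%:R].
Proof.
move=> A0 A_down.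
pose M : R := \sum_(v <- A) l1 (lattice_point R v).
have M0 : 0 <= M by rewrite sumr_ge0 // => v _; exact: l1_ge0.
(* For [v] in [A] this bounds [eps * l1 v] by M / (2 (1 + M)) < 1/2; the added 1 covers [M = 0]. *)
pose eps := (2 * (1 + M))^-1.
have eps_gt0 : 0 < eps by rewrite invr_gt0; lra.
have eps_small v : v \in A -> eps * l1 (lattice_point R v) < 1 / 2.
  move=> vA; have : l1 (lattice_point R v) <= M.
    rewrite /M (bigD1_seq v) ?fset_uniq //= lerDl big_seq_cond sumr_ge0 // => u _.
    exact: l1_ge0.
  by rewrite mulrC ltr_pdivrMr; lra.
exists [set z | potential A eps z = 1 / 2]; split.
- exact: level_sphere.
- exact: level_inside.
- by move=> e; exact: level_bond.
- by move=> z; exact: level_radius.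
Qed.

(** * Counting walks *)

Section Walks.
Variable d : nat.
Implicit Types (x y v a : vertex d) (p : seq (vertex d)).

Definition unit_step (k : 'I_d) (c : int) : vertex d := \row_j (if j == k then c else 0).

Definition last_nonzero x : pred 'I_d :=
  [pred k | (x ord0 k != 0) && [forall j : 'I_d, (k < j)%N ==> (x ord0 j == 0)]].

(* The origin is its own parent. *)
Definition parent x : vertex d :=
  if [pick k | last_nonzero x k] is Some k then x - unit_step k (Num.sg (x ord0 k)) else x.

Definition norm1 x : nat := (\sum_i absz (x ord0 i))%N.

Definition directions : seq (vertex d) :=
  [seq unit_step kc.1 (if kc.2 then 1 else -1) | kc <- enum {: 'I_d * bool}].

Definition nbrs x : seq (vertex d) := [seq x + u | u <- directions].

Lemma unit_stepE k c i : unit_step k c ord0 i = if i == k then c else 0.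
Proof. by rewrite mxE. Qed.

Lemma last_nonzero_inj x k k' : last_nonzero x k -> last_nonzero x k' -> k = k'.
Proof.
move=> /andP[xk /forallP h] /andP[xk' /forallP h']; apply/val_inj/eqP.
case: ltngtP => // lt.
  by have := h k'; rewrite lt (negbTE xk').
by have := h' k; rewrite lt (negbTE xk).
Qed.

Lemma parentE x k : last_nonzero x k -> parent x = x - unit_step k (Num.sg (x ord0 k)).
Proof.
move=> hk; rewrite /parent; case: pickP => [k' hk'|/(_ k)]; last by rewrite hk.
by rewrite (last_nonzero_inj hk hk').
Qed.

Lemma last_nonzero_ex x : x != 0 -> exists k, last_nonzero x k.
Proof.
move=> x0; have [k0 hk0] : exists k, x ord0 k != 0.
  apply: contrapT => no; move/negP: x0; apply; apply/eqP/row_ord0P => i.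
  by rewrite mxE; apply/eqP/negPn/negP => xi; apply: no; exists i.
case: (@arg_maxnP _ k0 (fun k => x ord0 k != 0) val hk0) => k xk mk.
exists k; rewrite /last_nonzero /= xk; apply/forallP => j; apply/implyP => kj.
by apply/negPn/negP => xj; have /= := mk _ xj; rewrite leqNgt kj.
Qed.

Lemma parent0 : parent 0 = 0.
Proof. by rewrite /parent; case: pickP => // k /andP[]; rewrite mxE eqxx. Qed.

Lemma norm1_update x y k : (forall i, i != k -> y ord0 i = x ord0 i) ->
  (norm1 y + absz (x ord0 k) = norm1 x + absz (y ord0 k))%N.
Proof.
move=> h; rewrite /norm1 (bigD1 k) //= [in RHS](bigD1 k) //=.
rewrite (eq_bigr (fun i => absz (x ord0 i))); last by move=> i /h ->.
by rewrite addnAC [RHS]addnAC [(absz (y _ _) + _)%N]addnC.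
Qed.

Lemma parent_coord x k i : last_nonzero x k ->
  parent x ord0 i = if i == k then x ord0 k - Num.sg (x ord0 k) else x ord0 i.
Proof.
by move=> /parentE ->; rewrite !mxE; case: eqP => [->|_] //; rewrite subr0.
Qed.

Lemma parent_norm1 x : x != 0 -> norm1 x = (norm1 (parent x)).+1.
Proof.
move=> /last_nonzero_ex[k hk]; have xk : x ord0 k != 0 by case/andP: hk.
have : (norm1 (parent x) + absz (x ord0 k) = norm1 x + absz (parent x ord0 k))%N.
  by apply: norm1_update => i /negbTE ik; rewrite (parent_coord _ hk) ik.
have -> : absz (x ord0 k) = (absz (parent x ord0 k)).+1.
  rewrite (parent_coord _ hk) eqxx.
  by case: (ltrgt0P (x ord0 k)) xk => //= c _; [rewrite gtr0_sg|rewrite ltr0_sg]; lia.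
by rewrite addnS -addSn => /addIn.
Qed.

Lemma nbrsP x y : (y \in nbrs x) = neighbours x y.
Proof.
apply/mapP/eqP => [[_ /mapP[[k b] _ ->] ->]|nxy].
  rewrite (bigD1 k) //= big1 => [|i /negbTE ik]; last by rewrite !mxE ik addr0 subrr expr0n.
  by rewrite !mxE eqxx opprD addNKr sqrrN; case: b.
have sq0 i : 0 <= (x ord0 i - y ord0 i) ^+ 2 by exact: sqr_ge0.
have [k hk] : exists k, x ord0 k != y ord0 k.
  apply: contrapT => no; move: nxy; rewrite big1 // => i _.
  by apply/eqP; rewrite sqrf_eq0 subr_eq0; apply/negPn/negP => h; apply: no; exists i.
have hk1 : 1 <= (x ord0 k - y ord0 k) ^+ 2.
  by rewrite -gtz0_ge1 exprn_even_gt0 //= subr_eq0.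
move: nxy; rewrite (bigD1 k) //=; set r := \sum_(i < d | i != k) _ => nxy.
have r0 : 0 <= r by rewrite sumr_ge0.
have re : r = 0 by move: nxy r0 hk1; lia.
have sk : (y ord0 k - x ord0 k) ^+ 2 = 1 by rewrite -sqrrN opprB -[RHS]nxy re addr0.
have yi i : i != k -> y ord0 i = x ord0 i.
  move=> ik; move/eqP: re; rewrite /r psumr_eq0 // => /allP /(_ i).
  by rewrite mem_index_enum ik sqrf_eq0 subr_eq0 => /(_ isT) /eqP.
exists (unit_step k (if 0 < y ord0 k - x ord0 k then 1 else -1)).
  apply/mapP; exists (k, 0 < y ord0 k - x ord0 k) => //.
  by rewrite mem_enum.
apply: row_ord0P => i; rewrite !mxE; case: (eqVneq i k) => [->|/yi ->]; last by rewrite addr0.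
move/eqP: sk; rewrite sqrf_eq1 => /orP[] /eqP e; rewrite e /= -e; lia.
Qed.

Lemma uniq_nbrs x : uniq (nbrs x).
Proof.
rewrite map_inj_uniq; last by move=> u v /addrI.
rewrite map_inj_uniq ?enum_uniq // => -[k b] [k' b'] /= e.
have ek := congr1 (fun u : vertex d => u ord0 k) e.
rewrite !unit_stepE eqxx in ek.
have kk : k == k' by move: ek; case: (k == k') => //; case: (b).
by move: ek; rewrite kk -(eqP kk); case: (b); case: (b').
Qed.

Lemma size_nbrs x : size (nbrs x) = (2 * d)%N.
Proof. by rewrite !size_map -enumT -cardT card_prod card_ord card_bool mulnC. Qed.

Lemma nbrs_sym x y : y \in nbrs x -> x \in nbrs y.
Proof. by rewrite !nbrsP neighboursC. Qed.

Lemma nbrs_irrefl x : x \notin nbrs x.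
Proof. by rewrite nbrsP; apply/negP => /neighbours_neq; rewrite eqxx. Qed.

Lemma nbrs_norm1 x y : y \in nbrs x -> (norm1 y <= (norm1 x).+1)%N.
Proof.
move=> /mapP[_ /mapP[[k b] _ ->] ->].
set z := (x + _)%R.
have : (norm1 z + absz (x ord0 k) = norm1 x + absz (z ord0 k))%N.
  by apply: norm1_update => i /negbTE ik; rewrite !mxE ik addr0.
have zk : (absz (z ord0 k) <= (absz (x ord0 k)).+1)%N.
  by rewrite !mxE eqxx /=; move: (x ord0 k) => c; case: (b); lia.
by rewrite -(leq_add2r (absz (x ord0 k))) => ->; rewrite addSnnS leq_add2l.
Qed.

Lemma parent_nbrs x : x != 0 -> parent x \in nbrs x.
Proof.
move=> /last_nonzero_ex[k hk]; rewrite (parentE hk); apply: map_f.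
apply/mapP; exists (k, x ord0 k < 0); first by rewrite mem_enum.
have xk : x ord0 k != 0 by case/andP: hk.
apply: row_ord0P => i; rewrite !mxE /=; case: eqP => _; rewrite ?oppr0 //.
by case: (ltrgt0P (x ord0 k)) xk => //= c _; [rewrite gtr0_sg|rewrite ltr0_sg // opprK].
Qed.

(** Walks without backtracking: [a] is the vertex from which [x] was entered, and the first step may
    not return to it. Started with [a = x], nothing is barred, since a vertex is not its own
    neighbour. *)
Fixpoint walks (n : nat) a x : seq (seq (vertex d)) :=
  if n is n'.+1 then
    flatten [seq [seq y :: p | p <- walks n' x y] | y <- nbrs x & y != a]
  else [:: [::]].

(** The edges that must be open for the walk to be allowed: a step to the parent is free. *)
Fixpoint upsteps x p : seq {fset vertex d} :=
  if p is y :: p' then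
    if y == parent x then upsteps y p' else [fset x; y]%fset :: upsteps y p'
  else [::].

Lemma mem_walks n a x p : path (fun x y => y \in nbrs x) x p -> size p = n ->
  uniq (x :: p) -> a \notin p -> p \in walks n a x.
Proof.
elim: n a x p => [|n IH] a x [|y p] //= /andP[xy pp] [sz] /andP[xp /andP[yp up]] ap.
apply/flattenP; exists [seq y :: q | q <- walks n x y].
  apply: map_f; rewrite mem_filter xy andbT.
  by move: ap; rewrite inE negb_or eq_sym => /andP[].
apply: map_f; apply: IH => //; first by rewrite /= yp.
by move: xp; rewrite inE negb_or => /andP[].
Qed.

Lemma walks_path n a x p : p \in walks n a x -> path (fun x y => y \in nbrs x) x p.
Proof.
elim: n a x p => [|n IH] a x p /=; first by rewrite inE => /eqP ->.
move=> /flattenP[s /mapP[y]]; rewrite mem_filter => /andP[_ xy] -> /mapP[q /IH qp ->] /=.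
by rewrite xy.
Qed.

Lemma upsteps_sub x p e v : e \in upsteps x p -> v \in e -> v \in x :: p.
Proof.
elim: p x => [|y p IH] x //=.
case: ifP => _; last rewrite inE => /orP[/eqP ->|].
- by move=> /IH h /h; rewrite [in X in _ -> X]inE => ->; rewrite orbT.
- by rewrite !inE => /orP[] ->; rewrite ?orbT.
- by move=> /IH h /h; rewrite [in X in _ -> X]inE => ->; rewrite orbT.
Qed.

(** A self-avoiding walk never returns to a vertex it has left, so it never crosses an edge twice.
    Independence then gives one factor [p] per recorded edge. *)
Lemma uniq_upsteps x p : uniq (x :: p) -> uniq (upsteps x p).
Proof.
elim: p x => [|y p IH] x //= /andP[xp /andP[yp up]].
have {}IH : uniq (upsteps y p) by apply: IH; rewrite /= yp.
case: ifP => _ //=; rewrite IH andbT; apply/negP => /upsteps_sub /(_ (fset21 _ _)).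
exact/negP.
Qed.

Lemma upsteps_edge x p e : path (fun x y => y \in nbrs x) x p -> e \in upsteps x p -> is_edge e.
Proof.
elim: p x => [|y p IH] x //= /andP[xy pp].
case: ifP => _; first exact: IH.
rewrite inE => /orP[/eqP ->|]; last exact: IH.
by apply/asboolP; exists x, y; rewrite -nbrsP.
Qed.

Section Weights.
Variables (R : realType) (q s : R).
Hypotheses (q_gt0 : 0 < q) (s_gt0 : 0 < s) (s_le1 : s <= 1).

Definition step_weight x y : R := if y == parent x then s else q / s.

Fixpoint walk_weight x p : R :=
  if p is y :: p' then step_weight x y * walk_weight y p' else 1.

Lemma step_weight_gt0 x y : 0 < step_weight x y.
Proof. by rewrite /step_weight; case: ifP => // _; rewrite divr_gt0. Qed.

Lemma walk_weight_gt0 x p : 0 < walk_weight x p.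
Proof. by elim: p x => [|y p IH] x //=; rewrite mulr_gt0 // step_weight_gt0. Qed.

(* Every parent step lowers the norm, so from the origin there are at most as many
   of them as other steps. *)
Lemma upsteps_walk_weight x p : path (fun x y => y \in nbrs x) x p ->
  q ^+ size (upsteps x p) * s ^+ norm1 x <= walk_weight x p.
Proof.
elim: p x => [|y p IH] x /=.
  by move=> _; rewrite mul1r exprn_ile1 // ltW.
move=> /andP[xy /IH {}IH]; rewrite /step_weight.
have w0 := walk_weight_gt0 y p.
case: ifPn => [/eqP ye|_] /=.
  have x0 : x != 0.
    by apply: contraTneq xy => x0; rewrite ye x0 parent0 nbrs_irrefl.
  by rewrite (parent_norm1 x0) -ye exprS mulrCA ler_pM2l.
have le : s ^+ (norm1 x).+1 <= s ^+ norm1 y.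
  by apply: ler_wiXn2l; [exact: ltW|exact: s_le1|exact: nbrs_norm1].
rewrite -[leRHS]mulrA exprS -mulrA ler_pM2l // ler_pdivlMl //.
apply: le_trans IH; rewrite mulrCA ler_wpM2l ?exprn_ge0 //; first exact: ltW.
by rewrite -exprS.
Qed.

Hypothesis q_le_ss : q <= s ^+ 2.

Definition rate : R := s + (2 * d%:R - 2) * (q / s).

Lemma rate_ge : (2 * d%:R - 1) * (q / s) <= rate.
Proof.
have : q / s <= s by rewrite ler_pdivrMr // -expr2.
rewrite /rate; lra.
Qed.

(** If the parent step is available, there remain 2d - 2 others, which gives exactly [rate]. If it
    is barred, or [x] is the origin, all 2d - 1 steps weigh [q / s], and [rate_ge] applies. *)
Lemma sum_nbrs_weight x a : a \in nbrs x ->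
  \sum_(y <- nbrs x | y != a) step_weight x y <= rate.
Proof.
move=> ax.
have bound (P : pred (vertex d)) : (forall y, P y -> y != parent x) ->
    \sum_(y <- nbrs x | P y) step_weight x y = (count P (nbrs x))%:R * (q / s).
  move=> hP; rewrite (eq_bigr (fun=> q / s)); last first.
    by move=> y /hP /negbTE yp; rewrite /step_weight yp.
  by rewrite big_const_seq iter_addr_0 mulr_natl.
have cnt1 v : v \in nbrs x -> count (pred1 v) (nbrs x) = 1%N.
  by move=> vx; rewrite count_uniq_mem ?uniq_nbrs // vx.
have cnta : (count (fun y => y != a) (nbrs x))%:R = 2 * d%:R - 1 :> R.
  have := count_predC (pred1 a) (nbrs x); rewrite cnt1 // size_nbrs => e.
  have -> : 2 * d%:R = (2 * d)%N%:R :> R by rewrite natrM.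
  by rewrite -e natrD addrAC subrr add0r.
have [px|px] := boolP ((parent x \in nbrs x) && (parent x != a)); last first.
  rewrite big_seq_cond (eq_bigl (fun y => (y \in nbrs x) && (y != a))) //.
  rewrite -big_seq_cond; apply: le_trans rate_ge.
  rewrite -cnta -big_filter; rewrite big_seq (eq_bigr (fun=> q / s)); last first.
    move=> y; rewrite mem_filter => /andP[ya yx]; rewrite /step_weight.
    by case: eqP => // e; move: px; rewrite -e yx ya.
  by rewrite -big_seq big_const_seq iter_addr_0 count_predT size_filter mulr_natl.
case/andP: px => px pa.
rewrite big_mkcond (bigD1_seq (parent x)) ?uniq_nbrs //= pa.
rewrite {1}/step_weight eqxx -big_mkcondr /= bound; last by move=> y /andP[].
suff -> : (count (fun y => (y != parent x) && (y != a)) (nbrs x))%:R = 2 * d%:R - 2 :> R by [].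
have := count_predC (pred1 (parent x)) [seq y <- nbrs x | y != a].
rewrite !count_filter size_filter.
have -> : count [predI pred1 (parent x) & (fun y => y != a)] (nbrs x) = 1%N.
  transitivity (count (pred1 (parent x)) (nbrs x)); last exact: cnt1.
  apply: eq_count => y; rewrite /= !inE; case: eqP => [->|//].
  by rewrite unfold_in /= pa.
move=> e; have := cnta; rewrite -e natrD /predI /= => h; lra.
Qed.

Hypothesis d_gt0 : (0 < d)%N.

Lemma rate_ge0 : 0 <= rate.
Proof.
apply: le_trans rate_ge; rewrite mulr_ge0 ?divr_ge0 ?(ltW q_gt0) ?(ltW s_gt0) //.
by have : 1 <= d%:R :> R; [rewrite ler1n|lra].
Qed.

Lemma sum_walk_weight n x a : a \in nbrs x ->
  \sum_(p <- walks n a x) walk_weight x p <= rate ^+ n.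
Proof.
elim: n a x => [|n IH] a x ax /=; first by rewrite big_seq1.
rewrite big_flatten /= big_map big_filter.
under eq_bigr do rewrite big_map /= -mulr_sumr.
rewrite exprS; apply: le_trans (ler_wpM2r (exprn_ge0 n rate_ge0) (sum_nbrs_weight ax)).
rewrite mulr_suml big_seq_cond [leRHS]big_seq_cond.
apply: ler_sum => y /andP[xy _]; rewrite ler_wpM2l ?(ltW (step_weight_gt0 _ _)) //.
exact/IH/nbrs_sym.
Qed.

(** At the origin nothing is barred and no step leads to a parent, so the first step contributes 2d
    times [q / s] instead of [rate]. *)
Lemma sum_walk_weight0 n :
  \sum_(p <- walks n.+1 0 0) walk_weight 0 p <= 2 * d%:R * (q / s) * rate ^+ n.
Proof.
rewrite /= big_flatten /= big_map big_filter.
under eq_bigr do rewrite big_map /= -mulr_sumr.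
have -> : 2 * d%:R = (size (nbrs 0))%:R :> R by rewrite size_nbrs natrM.
rewrite -count_predT -mulrA mulr_natl -iter_addr_0 -big_const_seq.
rewrite big_mkcond big_seq [leRHS]big_seq; apply: ler_sum => y y0.
have y_neq0 : y != 0 by apply: contraTneq y0 => ->; exact: nbrs_irrefl.
rewrite y_neq0 /step_weight parent0 (negbTE y_neq0) ler_wpM2l //.
  by rewrite divr_ge0 // ltW.
exact/sum_walk_weight/nbrs_sym.
Qed.

End Weights.
End Walks.

(** * Reachable vertices *)

Section CountableMeasurable.
Context (disp : measure_display) (T : measurableType disp).

Lemma measurable_exists (I : countType) (Q : I -> set T) :
  (forall i, measurable (Q i)) -> measurable [set w | exists i, Q i w].
Proof.
move=> mQ; rewrite [X in measurable X](_ : _ = \bigcup_i Q i).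
  by apply: countable_bigcupT_measurable => //; exact: countableP.
by apply/seteqP; split=> [w [i Qw]|w [i _ Qw]]; exists i.
Qed.

Lemma measurable_forall (I : countType) (Q : I -> set T) :
  (forall i, measurable (Q i)) -> measurable [set w | forall i, Q i w].
Proof.
move=> mQ; rewrite [X in measurable X](_ : _ = ~` [set w | exists i, (~` Q i) w]).
  by apply: measurableC; apply: measurable_exists => i; exact: measurableC.
apply/seteqP; split=> [w Qw [i nQ]|w nQ i]; first by apply: nQ; exact: Qw.
by apply: contrapT => nQw; apply: nQ; exists i.
Qed.

Lemma measurable_prop (C : Prop) : measurable [set _ : T | C].
Proof.
have [c|c] := pselect C.
  by rewrite [X in measurable X](_ : _ = setT) //; apply/seteqP; split.
by rewrite [X in measurable X](_ : _ = set0) //; apply/seteqP; split.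
Qed.

Lemma measurable_and (A B : set T) : measurable A -> measurable B ->
  measurable [set w | A w /\ B w].
Proof. exact: measurableI. Qed.

Lemma measurable_imply (C : Prop) (A : set T) : measurable A ->
  measurable [set w | C -> A w].
Proof.
move=> mA; have [c|c] := pselect C.
  by rewrite [X in measurable X](_ : _ = A) //; apply/seteqP; split=> w //=; auto.
by rewrite [X in measurable X](_ : _ = setT) //; apply/seteqP; split=> // w _ /c.
Qed.

Lemma measure_exists_seq_le (R : realType) (mu : {measure set T -> \bar R})
    (I : eqType) (s : seq I) (Q : I -> set T) : (forall i, measurable (Q i)) ->
  (mu [set w | exists2 i, i \in s & Q i w] <= \sum_(i <- s) mu (Q i))%E.
Proof.
move=> mQ.
have H : measurable [set w | exists2 i, i \in s & Q i w] /\
    (mu [set w | exists2 i, i \in s & Q i w] <= \sum_(i <- s) mu (Q i))%E.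
  elim: s => [|i s [mS IH]].
    rewrite [X in measurable X](_ : _ = set0) ?[X in mu X](_ : _ = set0).
    - by rewrite measure0 big_nil.
    - by apply/seteqP; split=> w // [].
    - by apply/seteqP; split=> w // [].
  have -> : [set w | exists2 j, j \in i :: s & Q j w] =
      Q i `|` [set w | exists2 i, i \in s & Q i w].
    apply/seteqP; split=> w /=.
      by move=> [j]; rewrite inE => /orP[/eqP ->|js] Qj; [left|right; exists j].
    by case=> [Qi|[j js Qj]]; [exists i; rewrite ?mem_head|exists j; rewrite // inE js orbT].
  split; first exact: measurableU.
  by rewrite big_cons; apply: le_trans (measureU2 _ _ _) _ => //; rewrite leeD2l.
exact: H.2.
Qed.

End CountableMeasurable.

Section Reach.
Variable d : nat.
Implicit Types (x y v : vertex d) (w : config d) (p : seq (vertex d)).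

Definition step w x y : bool :=
  (y == parent x) || `[< exists2 e : edge d, val e = [fset x; y]%fset & w e >].

Definition reach w : set (vertex d) :=
  [set v | exists2 p, path (step w) 0 p & last 0 p = v].

Lemma reach0 w : reach w 0. Proof. by exists [::]. Qed.

Lemma reach_step w x y : reach w x -> step w x y -> reach w y.
Proof.
move=> [p pp <-] s; exists (rcons p y); last by rewrite last_rcons.
by rewrite rcons_path pp.
Qed.

Lemma reach_parent w x : reach w x -> reach w (parent x).
Proof. by move=> /reach_step; apply; rewrite /step eqxx. Qed.

Lemma reach_edge w (e : edge d) x y : reach w x -> val e = [fset x; y]%fset -> w e -> reach w y.
Proof.
by move=> /reach_step h eE we; apply: h; apply/orP; right; apply/asboolP; exists e.
Qed.

(** As long as coordinate [k] of [x] differs from that of [x'], it is the last nonzero one, so a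
    parent step moves it by one unit towards 0 and hence towards [x']. *)
Lemma reach_down w (x x' : vertex d) (k : 'I_d) : reach w x ->
  (forall j : 'I_d, (j < k)%N -> x' ord0 j = x ord0 j) ->
  (forall j : 'I_d, (k < j)%N -> x ord0 j = 0) ->
  (forall j : 'I_d, (k < j)%N -> x' ord0 j = 0) ->
  (0 <= x' ord0 k <= x ord0 k) || (x ord0 k <= x' ord0 k <= 0) -> reach w x'.
Proof.
have [n] := ubnP (absz (x ord0 k - x' ord0 k)); elim: n x => // n IH x nk rx lo hi hi' btw.
have [e|ne] := eqVneq (x ord0 k) (x' ord0 k).
  suff -> : x' = x by [].
  apply: row_ord0P => j; case: (ltngtP j k) => [/lo//|jk|/val_inj -> //].
  by rewrite hi // hi'.
have xk : x ord0 k != 0.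
  by apply: contraNneq ne => x0; move: btw; rewrite x0 => ?; apply/eqP; lia.
have lk : last_nonzero x k.
  by rewrite /last_nonzero /= xk; apply/forallP => j; apply/implyP => /hi ->.
have pk : parent x ord0 k = x ord0 k - Num.sg (x ord0 k).
  by rewrite (parent_coord _ lk) eqxx.
have pj (j : 'I_d) : j != k -> parent x ord0 j = x ord0 j.
  by move=> /negbTE jk; rewrite (parent_coord _ lk) jk.
have sgx : Num.sg (x ord0 k) = if 0 < x ord0 k then 1 else -1.
  by case: (ltrgt0P (x ord0 k)) xk => //= c _; [rewrite gtr0_sg|rewrite ltr0_sg].
apply: (IH (parent x)).
- by rewrite pk sgx; move: btw ne xk nk; move: (x ord0 k) (x' ord0 k) => a b; case: ifP; lia.
- exact: reach_parent.
- by move=> j jk; rewrite pj ?lo // -val_eqE /= ltn_eqF.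
- by move=> j jk; rewrite pj ?hi // -val_eqE /= gtn_eqF.
- exact: hi'.
- by rewrite pk sgx; move: btw ne xk; move: (x ord0 k) (x' ord0 k) => a b; case: ifP; lia.
Qed.

Lemma step_path_nbrs w x p : path (step w) x p -> uniq (x :: p) ->
  path (fun x y => y \in nbrs x) x p.
Proof.
elim: p x => [|y p IH] x //= /andP[xy pp] /and3P[xp yp up].
apply/andP; split; last by apply: IH; rewrite //= yp.
move: xp; rewrite inE negb_or => /andP[ne _].
case/orP: xy => [/eqP ye|/asboolP[e eE _]].
  rewrite ye parent_nbrs //; apply: contraNneq ne => x0.
  by rewrite ye x0 parent0.
by rewrite nbrsP; exact: edge_neighbours eE.
Qed.

Lemma step_path_upsteps w x p (e : edge d) : path (step w) x p ->
  val e \in upsteps x p -> w e.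
Proof.
elim: p x => [|y p IH] x //= /andP[xy pp].
case: ifPn => [_|ne]; first exact: IH.
rewrite inE => /orP[/eqP eE|]; last exact: IH.
case/orP: xy => [/eqP ye|/asboolP[e' e'E we']]; first by rewrite ye eqxx in ne.
by have -> : e = e' by apply: val_inj; rewrite e'E.
Qed.

Lemma path_norm1 x p : path (fun x y => y \in nbrs x) x p ->
  (norm1 (last x p) <= norm1 x + size p)%N.
Proof.
elim: p x => [|y p IH] x /=; first by rewrite addn0.
move=> /andP[/nbrs_norm1 xy /IH le]; apply: leq_trans le _.
by rewrite addnS -addSn leq_add2r.
Qed.

(** A finite union of cylinder events containing the event that a vertex of norm at least [n] is
    reached; the union bound over walks applies to it. *)
Definition far (n : nat) : set (config d) :=
  [set w | exists2 p, p \in walks n 0 0 &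
     uniq (0 :: p) /\ forall e : edge d, val e \in upsteps 0 p -> w e].

Lemma norm1_0 : norm1 (0 : vertex d) = 0%N.
Proof. by rewrite /norm1 big1 // => i _; rewrite mxE. Qed.

(** Loops are removed from a path to [v]. Each step raises the norm by at most 1, so at least [n]
    steps remain, and the first [n] of them form the required walk. *)
Lemma reach_far w v n : reach w v -> (n <= norm1 v)%N -> far n w.
Proof.
move=> [p0 pp0 <-]; case: (shortenP pp0) => p pp up _ nv.
have np := step_path_nbrs pp up.
have sz : (n <= size p)%N by have := path_norm1 np; rewrite norm1_0; exact: leq_trans.
have ut : uniq (0 :: take n p).
  by apply: subseq_uniq up; rewrite /= eqxx take_subseq.
exists (take n p).
  apply: mem_walks => //; first exact: take_path.
    by rewrite size_takel.
  by case/andP: ut.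
split=> // e; apply: step_path_upsteps; exact: take_path.
Qed.

Lemma measurable_open (e : edge d) : measurable [set w : config d | w e].
Proof. by apply: sub_sigma_algebra; exists e. Qed.

Lemma measurable_opened (es : seq {fset vertex d}) :
  measurable [set w : config d | forall e : edge d, val e \in es -> w e].
Proof.
by apply: measurable_forall => e; apply: measurable_imply; exact: measurable_open.
Qed.

Lemma measurable_far n : measurable (far n).
Proof.
rewrite [X in measurable X](_ : _ = [set w : config d |
    exists p : seq (vertex d), p \in walks n 0 0 /\
    uniq (0 :: p) /\ forall e : edge d, val e \in upsteps 0 p -> w e]).
  apply: measurable_exists => p; apply: measurable_and; first exact: measurable_prop.
  apply: measurable_and; first exact: measurable_prop.
  exact: measurable_opened.
by apply/seteqP; split=> [w [p ? ?]|w [p [? ?]]]; exists p.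
Qed.

Lemma measurable_step x y : measurable [set w : config d | step w x y].
Proof.
rewrite [X in measurable X](_ : _ = [set w : config d | y = parent x] `|`
  [set w : config d | exists e : edge d, val e = [fset x; y]%fset /\ w e]).
  apply: measurableU; first exact: measurable_prop.
  apply: measurable_exists => e; apply: measurable_and; first exact: measurable_prop.
  exact: measurable_open.
apply/seteqP; split=> w /=.
  by case/orP => [/eqP|/asboolP[e ? ?]]; [left|right; exists e].
case=> [->|[e [? ?]]]; apply/orP; [by left|right].
by apply/asboolP; exists e.
Qed.

Lemma measurable_reach v : measurable [set w : config d | reach w v].
Proof.
have mp x p : measurable [set w : config d | path (step w) x p].
  elim: p x => [|y p IH] x /=; first exact: measurable_prop.
  rewrite [X in measurable X](_ : _ = [set w : config d | step w x y] `&`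
      [set w : config d | path (step w) y p]).
    by apply: measurableI; [exact: measurable_step|exact: IH].
  by apply/seteqP; split=> w /= => [/andP|[-> ->]].
rewrite [X in measurable X](_ : _ = [set w : config d |
    exists p : seq (vertex d), path (step w) 0 p /\ last 0 p = v]).
  by apply: measurable_exists => p; apply: measurable_and; [exact: mp|exact: measurable_prop].
by apply/seteqP; split=> [w [p ? ?]|w [p [? ?]]]; exists p.
Qed.

Lemma measurable_reach_eq (F : {fset vertex d}) :
  measurable [set w : config d | reach w = [set` F]].
Proof.
rewrite [X in measurable X](_ : _ = [set w : config d |
    forall v : vertex d, (v \in F -> reach w v) /\
    (v \notin F -> (~` [set w : config d | reach w v]) w)]).
  apply: measurable_forall => v; apply: measurable_and; apply: measurable_imply.
    exact: measurable_reach.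
  by apply: measurableC; exact: measurable_reach.
apply/seteqP; split=> w /= => [-> v|h]; first by split=> [//|/negP].
apply/seteqP; split=> v /=; last by case: (h v).
by move=> rv; apply/negPn/negP => /(h v).2.
Qed.

Lemma finite_vertex_box (n : nat) :
  finite_set [set v : vertex d | forall i, (absz (v ord0 i) <= n)%N].
Proof.
pose f (g : {ffun 'I_d -> 'I_(n.*2.+1)}) : vertex d := \row_i ((g i : nat)%:Z - n%:Z).
apply: (@sub_finite_set _ _ (f @` setT)); last exact: finite_image.
move=> v hv; exists [ffun i => inord (absz (v ord0 i + n%:Z))] => //.
apply: row_ord0P => i; rewrite mxE ffunE; have := hv i; move: (v ord0 i) => c hc.
by rewrite inordK; lia.
Qed.

Lemma far_infinite w : infinite_set (reach w) -> forall n, far n w.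
Proof.
move=> inf n; apply: contrapT => nfar; apply: inf.
apply: sub_finite_set (finite_vertex_box n) => v rv i.
rewrite leqNgt; apply/negP => h; apply: nfar; apply: (reach_far rv).
by rewrite (leq_trans (ltnW h)) // /norm1 (bigD1 i) //= leq_addr.
Qed.

End Reach.

(** * Probability of a long walk *)

Section FarBound.
Variables (R : realType) (d : nat) (p q s : R).
Hypotheses (p01 : 0 <= p <= 1) (q_gt0 : 0 < q) (pq : p <= q).
Hypotheses (s_gt0 : 0 < s) (s_le1 : s <= 1) (q_le_ss : q <= s ^+ 2) (d_gt0 : (0 < d)%N).
Let P := percolation d p.

Lemma probability_opened (es : seq {fset vertex d}) : uniq es ->
  (forall e, e \in es -> is_edge e) ->
  P [set w : config d | forall e : edge d, val e \in es -> w e] = (p ^+ size es)%:E.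
Proof.
move=> ues eses; pose F : {fset edge d} := [fset e in (pmap insub es : seq (edge d))]%fset.
have memF (e : edge d) : (e \in F) = (val e \in es) by rewrite !inE mem_pmap_sub.
have := (@percolationP R d p p01); move=> /(_ F (fun=> true)).
rewrite big_const_seq count_predT iter_mulr_1 => e.
have szF : size F = size es.
  rewrite (perm_size (_ : perm_eq F (pmap insub es : seq (edge d)))).
    rewrite size_pmap_sub; apply/eqP; rewrite -all_count.
    by apply/allP => x /eses.
  apply: uniq_perm; rewrite ?fset_uniq ?pmap_sub_uniq // => x.
  by rewrite memF mem_pmap_sub.
rewrite szF in e; rewrite /P -e; congr (percolation d p _).
by apply/seteqP; split=> w /= h x; have := h x; rewrite memF.
Qed.

Lemma probability_far n :
  (P (far n.+1) <= (2 * d%:R * (q / s) * rate d q s ^+ n)%:E)%E.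
Proof.
pose Q (x : seq (vertex d)) : set (config d) :=
  [set w | uniq (0 :: x) /\ forall e : edge d, val e \in upsteps 0 x -> w e].
have mQ x : measurable (Q x).
  by apply: measurable_and; [exact: measurable_prop|exact: measurable_opened].
rewrite -[far n.+1]/[set w : config d | exists2 x, x \in walks n.+1 0 0 & Q x w].
apply: le_trans (measure_exists_seq_le _ _ mQ) _.
have := sum_walk_weight0 q_gt0 s_gt0 q_le_ss d_gt0 n; rewrite -lee_fin -sumEFin.
apply: le_trans; rewrite big_seq [leRHS]big_seq; apply: lee_sum => x xw.
have [ux|nux] := boolP (uniq (0 :: x)); last first.
  rewrite (_ : Q x = set0) ?measure0 ?lee_fin ?ltW ?walk_weight_gt0 //.
  by apply/seteqP; split=> // w [] /(negP nux).
have -> : Q x = [set w : config d | forall e : edge d, val e \in upsteps 0 x -> w e].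
  by apply/seteqP; split=> [w []|w h] //; split.
have px := walks_path xw.
have eP := probability_opened (uniq_upsteps ux) (fun e => upsteps_edge px).
apply: (@le_trans _ _ (p ^+ size (upsteps 0 x))%:E); first by rewrite -eP.
rewrite lee_fin; apply: le_trans (upsteps_walk_weight q_gt0 s_gt0 s_le1 px).
(* The walk starts at the origin, where the factor [s ^+ norm1 x] of the weight bound is 1. *)
rewrite norm1_0 expr0 mulr1; apply: lerXn2r => //; rewrite nnegrE ?(ltW q_gt0) //.
by case/andP: p01.
Qed.

End FarBound.

(** * The random sphere and the tail of its radius *)

Section RandomSphere.
Variables (R : realType) (d : nat).
Local Notation space := 'rV[R]_d.
Local Notation lp := (lattice_point R).
Implicit Types (w : config d) (F : {fset vertex d}).

Definition surrounds F (S : set space) : Prop :=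
  [/\ sphere S, inside S 0,
      forall e : edge d, bond e `&` S !=set0 ->
        exists x y, [/\ val e = [fset x; y]%fset, x \in F & y \notin F] &
      forall z, S z -> exists2 v, v \in F & l1 z <= l1 (lp v) + d%:R].

(** The choice depends on the finite set [F] only. So the random sphere takes countably many values,
    each on a measurable event, and its radius is measurable. *)
Definition sphere_for F : set space := xget set0 (surrounds F).

Definition random_sphere w : set space :=
  if pselect (finite_set (reach w)) then sphere_for (fset_set (reach w)) else set0.

Lemma random_sphere_surrounds w : finite_set (reach w) ->
  surrounds (fset_set (reach w)) (random_sphere w).
Proof.
move=> fin; rewrite /random_sphere; case: pselect => // fin'; rewrite /sphere_for.
apply: xgetPex; apply: surrounding_sphere.
  by rewrite in_fset_set // inE; exact: reach0.
move=> x x' k; rewrite !in_fset_set // !inE; exact: reach_down.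
Qed.

Lemma random_sphere_closed w : finite_set (reach w) ->
  closed_sphere_around_origin w (random_sphere w).
Proof.
move=> fin; have [sS iS bS _] := random_sphere_surrounds fin; split => // e /bS.
move=> [x [y [eE]]]; rewrite !in_fset_set // inE notin_setE => rx nry.
by apply/negbTE/negP => we; apply: nry; exact: reach_edge rx eE we.
Qed.

Lemma l1_lattice_point (v : vertex d) : l1 (lp v) = (norm1 v)%:R.
Proof.
rewrite /l1 /norm1 natr_sum; apply: eq_bigr => i _.
by rewrite mxE -intr_norm -abszE.
Qed.

(** A sphere reaching beyond [n + d] forces a reached vertex of norm at least [n], as the sphere
    exceeds the reached set by at most [d]. An infinite reached set lies in [far n] anyway. *)
Lemma radius_far w (r : R) n : n%:R + d%:R < r -> (r%:E <= l1_radius (random_sphere w))%E ->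
  far n w.
Proof.
move=> nr rS; have [fin|inf] := pselect (finite_set (reach w)); last exact: far_infinite.
have [_ _ _ radS] := random_sphere_surrounds fin.
have [z Sz lz] : exists2 z, random_sphere w z & n%:R + d%:R < l1 z.
  apply: contrapT => no; move: rS; apply/negP; rewrite -ltNge.
  apply: (@le_lt_trans _ _ (n%:R + d%:R)%:E); last by rewrite lte_fin.
  apply: ge_ereal_sup => _ [z Sz <-]; rewrite lee_fin leNgt; apply/negP => lz.
  by apply: no; exists z.
have [v] := radS _ Sz; rewrite in_fset_set // inE l1_lattice_point => rv lv.
apply: (reach_far rv); rewrite -(ler_nat R); lra.
Qed.

Lemma measurable_radius : measurable_fun [set: config d] (fun w => l1_radius (random_sphere w)).
Proof.
move=> _ Y mY; rewrite setTI.
rewrite [X in measurable X](_ : _ =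
  [set w : config d | exists F : {fset vertex d},
    reach w = [set` F] /\ Y (l1_radius (sphere_for F))]
  `|` (~` [set w : config d | exists F : {fset vertex d}, reach w = [set` F]] `&`
       [set w : config d | Y (l1_radius (set0 : set space))])).
  apply: measurableU.
    apply: measurable_exists => F; apply: measurable_and; last exact: measurable_prop.
    exact: measurable_reach_eq.
  apply: measurableI; last exact: measurable_prop.
  by apply: measurableC; apply: measurable_exists => F; exact: measurable_reach_eq.
apply/seteqP; split=> w /=; rewrite /random_sphere; case: pselect => [fin|inf] /=.
- by move=> Yw; left; exists (fset_set (reach w)); rewrite fset_setK.
- by move=> Y0; right; split=> // -[F e]; apply: inf; rewrite e; exact: finite_fset.
- case=> [[F [e YF]]|[no _]]; first by rewrite e set_fsetK.
  by case: no; apply/finite_fsetP.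
- by case=> [[F [e _]]|[]] //; case: inf; rewrite e; exact: finite_fset.
Qed.

Section Tail.
Variables (p q : R).
Hypotheses (hd : (3 <= d)%N) (p01 : 0 <= p <= 1) (q_gt0 : 0 < q) (pq : p <= q).
Hypothesis q_lt : q < 1 / (8 * (d%:R - 1)).
Let P := percolation d p.
Let alpha0 : R := Num.sqrt (8 * q * (d%:R - 1)).

Let d_ge3 : 3 <= d%:R :> R.
Proof. by rewrite (ler_nat R 3). Qed.

Let q_small : 8 * q * (d%:R - 1) < 1.
Proof. by have := q_lt; have := d_ge3 => d3; rewrite ltr_pdivlMr; lra. Qed.

Lemma alpha0_lt1 : alpha0 < 1.
Proof. by rewrite -sqrtr1 ltr_sqrt ?ltr01 ?q_small. Qed.

Lemma probability_far_alpha : exists2 K, 0 < K &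
  forall n, (P (far n.+1) <= (K * alpha0 ^+ n)%:E)%E.
Proof.
(* With [s] the square root of [a], the two terms of [rate], [s] and (2d - 2) q / s, are equal. This
   choice minimizes their sum, which is then 2 s = [alpha0]. *)
have d3 := d_ge3; pose a := 2 * q * (d%:R - 1).
have a0 : 0 < a by rewrite !mulr_gt0 //; lra.
pose s := Num.sqrt a.
have s0 : 0 < s by rewrite sqrtr_gt0.
have ss : s ^+ 2 = a by rewrite sqr_sqrtr // ltW.
have s1 : s <= 1 by rewrite -sqrtr1 ler_sqrt // /a; have := q_small; lra.
have qs : q <= s ^+ 2.
  have : 0 <= q * (2 * d%:R - 3) by rewrite mulr_ge0 ?(ltW q_gt0) //; lra.
  by rewrite ss /a; lra.
have rE : rate d q s = alpha0.
  have -> : alpha0 = 2 * s.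
    rewrite /alpha0 /s; have -> : 8 * q * (d%:R - 1) = 2 ^+ 2 * a by rewrite /a; ring.
    by rewrite sqrtrM ?sqrtr_sqr ?ger0_norm ?sqr_ge0.
  rewrite /rate mulrA; have -> : (2 * d%:R - 2) * q = s * s by rewrite -expr2 ss /a; ring.
  by rewrite mulfK ?gt_eqF //; ring.
exists (2 * d%:R * (q / s)); first by rewrite !mulr_gt0 ?invr_gt0 //; lra.
move=> n; rewrite -rE; apply: probability_far => //.
by rewrite (leq_trans _ hd).
Qed.

Lemma far_eventually_small (e : R) : 0 < e -> exists n, (P (far n) < e%:E)%E.
Proof.
move=> e0; have [K K0 hK] := probability_far_alpha.
have a0 : 0 <= alpha0 by exact: sqrtr_ge0.
have : (K * alpha0 ^+ n @[n --> \oo] --> K * 0)%classic.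
  by apply: cvgMl_tmp; apply: cvg_expr; rewrite ger0_norm // alpha0_lt1.
rewrite mulr0 => /cvgrPdist_lt /(_ _ e0)[N _ /(_ N (leqnn N))] /=.
rewrite sub0r normrN ger0_norm ?mulr_ge0 ?exprn_ge0 ?(ltW K0) // => lt.
by exists N.+1; apply: le_lt_trans (hK N) _; rewrite lte_fin.
Qed.

(** An infinite reached set puts the configuration in every [far n], and these events have
    probabilities tending to 0. *)
Lemma reach_finite_ae : \forall w \ae P, finite_set (reach w).
Proof.
exists (\bigcap_n far n); split.
- by apply: bigcap_measurableType => n _; exact: measurable_far.
- apply/eqP; rewrite eq_le measure_ge0 andbT; apply/lee_addgt0Pr => e e0.
  have [n hn] := far_eventually_small e0; rewrite add0e.
  apply: le_trans (ltW hn); apply: le_measure; rewrite ?inE.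
  + by apply: bigcap_measurableType => k _; exact: measurable_far.
  + exact: measurable_far.
  + by move=> w /(_ n I).
- by move=> w /far_infinite inf n _; exact: inf.
Qed.

Lemma radius_tail (alpha : R) : alpha0 < alpha < 1 -> exists2 C, 0 < C &
  forall r : R, 0 < r ->
    (P [set w | (r%:E <= l1_radius (random_sphere w))%E] <= (C * alpha `^ r)%:E)%E.
Proof.
move=> /andP[aa a1]; have [K K0 hK] := probability_far_alpha.
have a00 : 0 <= alpha0 by exact: sqrtr_ge0.
have a_gt0 : 0 < alpha by exact: le_lt_trans aa.
(* For [r > m] and [n] the integer part of [r - m], this offset ensures [n.+1 + d < r], as
   [radius_far] requires, while [r <= n + m.+1]. *)
pose m := (d + 3)%N.
have mE : m%:R = d%:R + 3 :> R by rewrite natrD.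
have am : 0 < alpha ^+ m.+1 by rewrite exprn_gt0.
(* The term 1 covers [r <= m], where the probability is bounded by 1; the term [K] covers larger
   [r]. The denominator pays for replacing the exponent [n] by [n + m.+1]. *)
exists ((K + 1) / alpha ^+ m.+1); first by rewrite divr_gt0 //; lra.
move=> r r0.
have mrad : measurable [set w | (r%:E <= l1_radius (random_sphere w))%E].
  have := measurable_radius measurableT (emeasurable_itv `[r%:E, +oo[).
  rewrite setTI; congr measurable; apply/seteqP.
  by split=> w /=; rewrite in_itv /= andbT.
have powr_ge n : r <= n%:R -> alpha ^+ n <= alpha `^ r.
  by move=> rn; rewrite -powR_mulrn ?(ltW a_gt0) //; apply: ger_powR => //; rewrite a_gt0 (ltW a1).
have [rm|mr] := leP r m%:R.
  apply: (@le_trans _ _ 1%E); first exact: probability_le1.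
  rewrite lee_fin mulrAC ler_pdivlMr // mul1r.
  apply: (@le_trans _ _ (alpha `^ r)).
    by apply: powr_ge; rewrite (le_trans rm) // ler_nat.
  by rewrite ler_peMl ?powR_ge0 //; lra.
have rm0 : 0 <= r - m%:R by rewrite subr_ge0 ltW.
have /andP[n1 n2] := truncn_itv rm0; set n := Num.truncn _ in n1 n2.
apply: (@le_trans _ _ (P (far n.+1))).
  apply: le_measure; rewrite ?inE //; first exact: measurable_far.
  move=> w; apply: radius_far; rewrite -natr1; rewrite mE in n1; lra.
apply: le_trans (hK n) _; rewrite lee_fin mulrAC ler_pdivlMr //.
apply: (@le_trans _ _ (K * alpha ^+ (n + m.+1))).
  rewrite exprD mulrA ler_wpM2r ?(ltW am) // ler_wpM2l ?(ltW K0) //.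
  by apply: lerXn2r; rewrite ?nnegrE ?(ltW a_gt0) // ltW.
apply: ler_pM; rewrite ?exprn_ge0 ?(ltW K0) ?(ltW a_gt0) //; first lra.
by apply: powr_ge; rewrite -addSnnS natrD; lra.
Qed.

End Tail.
End RandomSphere.

(** * The critical probability *)

Section SphereEvent.
Variables (R : realType) (d : nat).
Local Notation space := 'rV[R]_d.
Local Notation lp := (lattice_point R).
Implicit Types (w : config d) (A : set space).

Lemma underlying_set_bounded (K : {fset {fset space}}) :
  exists M : R, forall x, underlying_set K x -> forall i, `|x ord0 i| <= M.
Proof.
pose N (V : {fset space}) := \sum_(v <- V) `|v|.
have N0 V : 0 <= N V by rewrite sumr_ge0.
exists (\sum_(V <- K) N V) => z [V /= VK [w [w0 w1 ->]]] i.
apply: (@le_trans _ _ (N V)); last first.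
  by rewrite [leRHS](bigD1_seq V) ?fset_uniq //= lerDl sumr_ge0.
rewrite summxE; apply: le_trans (ler_norm_sum _ _ _) _.
rewrite [leRHS]big_seq big_seq; apply: ler_sum => v vV.
rewrite mxE normrM -[leRHS]mul1r; apply: ler_pM; rewrite ?normr_ge0 ?coord_le_norm //.
rewrite ger0_norm ?w0 // -w1 (bigD1_seq v) ?fset_uniq //= lerDl.
by rewrite big_seq_cond sumr_ge0 // => u /andP[/w0].
Qed.

Lemma neighbours_coord (x y : vertex d) i : neighbours x y -> `|x ord0 i - y ord0 i| <= 1.
Proof. by move=> /neighbours_kuhn /andP[_ /forallP]. Qed.

Lemma bond_end_near (e : edge d) (x y : vertex d) (t : R) i : val e = [fset x; y]%fset ->
  0 <= t <= 1 ->
  `|(x ord0 i)%:~R| <= `|((1 - t) *: lp x + t *: lp y) ord0 i| + 1 :> R.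
Proof.
move=> eE /andP[t0 t1]; have := neighbours_coord i (edge_neighbours eE).
rewrite !mxE -(ler_int R) intr_norm intrB.
set a := (x ord0 i)%:~R; set b := (y ord0 i)%:~R => ab.
have {1}-> : a = (1 - t) * a + t * b + t * (a - b) by ring.
apply: le_trans (ler_normD _ _) _; rewrite lerD2l normrM ger0_norm //.
by rewrite mulr_ile1.
Qed.

(** A finite simplicial complex is bounded, and the ends of a bond meeting it lie within distance 1
    of it in each coordinate. *)
Lemma finite_bonds_met A : sphere A -> finite_set [set e : edge d | bond e `&` A !=set0].
Proof.
move=> [[K [_ AK]] _ _]; have [M hM] := underlying_set_bounded K.
pose n := Num.truncn (`|M| + 1).
pose B := [set v : vertex d | forall i, (absz (v ord0 i) <= n)%N].
have fB : finite_set B by exact: finite_vertex_box.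
have inB (x y : vertex d) (e : edge d) t : val e = [fset x; y]%fset -> 0 <= t <= 1 ->
    A ((1 - t) *: lp x + t *: lp y) -> B x.
  move=> eE t01; rewrite AK => /hM Mz i; rewrite /n truncn_ge_nat; last by rewrite addr_ge0.
  rewrite natr_absz intr_norm; apply: le_trans (bond_end_near i eE t01) _.
  by rewrite lerD2r; apply: le_trans (Mz i) (ler_norm M).
pose pairs := [set [fset x; y]%fset | x in B & y in B].
have -> : [set e : edge d | bond e `&` A !=set0] =
    [set e : edge d | bond e `&` A !=set0] `&` (fun e : edge d => val e) @^-1` pairs.
  apply/seteqP; split=> [e [z [[x [y [t [eE t01 zE]]]] Az]]|e []//]; split.
    by exists z; split=> //; exists x, y, t.
  rewrite zE in Az; exists x; first exact: inB eE t01 Az.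
  exists y; last by rewrite eE.
  apply: (inB y x e (1 - t)); first by rewrite eE fsetUC.
    by move: t01 => /andP[? ?]; apply/andP; split; lra.
  rewrite addrC; have -> : 1 - (1 - t) = t by ring.
  exact: Az.
apply: finite_setIr; apply: finite_preimage; last exact: finite_image2.
by move=> e e' _ _; exact: val_inj.
Qed.

Definition separates A : Prop := sphere A /\ inside A 0.

(** The union over uncountably many spheres becomes countable when spheres are grouped by a finite
    set [F] of edges containing all those they meet. For fixed [F], the existence of such a sphere
    is deterministic, and only the closedness of [F] is random. *)
Lemma measurable_sphere_event : measurable (@sphere_event R d).
Proof.
rewrite [X in measurable X](_ : _ = [set w : config d | exists F : {fset edge d},
    (exists A, separates A /\ forall e : edge d, bond e `&` A !=set0 -> e \in F) /\
    forall e : edge d, e \in F -> (~` [set w : config d | w e]) w]).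
  apply: measurable_exists => F; apply: measurable_and; first exact: measurable_prop.
  apply: measurable_forall => e; apply: measurable_imply; apply: measurableC.
  exact: measurable_open.
apply/seteqP; split=> w.
  move=> [A [sA cA iA]]; have fin := finite_bonds_met sA.
  exists (fset_set [set e : edge d | bond e `&` A !=set0]); split.
    by exists A; split=> // e hit; rewrite in_fset_set // inE.
  by move=> e; rewrite in_fset_set // inE /= => /cA ->.
move=> [F [[A [[sA iA] AF]] cF]]; exists A; split=> // e /AF /cF /=.
by move/negP/negbTE.
Qed.

Lemma axis_bond (k : 'I_d) (t : R) : 0 <= t ->
  exists e : edge d, bond e (t *: lp (unit_step k 1)).
Proof.
move=> t0; have /andP[n1 n2] := truncn_itv t0; set n := Num.truncn t in n1 n2.
pose x := unit_step k n%:Z; pose y := unit_step k n.+1%:Z.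
have nxy : neighbours x y.
  rewrite /neighbours (bigD1 k) //= big1 => [|i /negbTE ik]; last first.
    by rewrite !unit_stepE ik subrr expr0n.
  by rewrite !unit_stepE eqxx addr0 (_ : n%:Z - n.+1%:Z = -1) //; lia.
have ed : is_edge [fset x; y]%fset by apply/asboolP; exists x, y.
exists (Sub [fset x; y]%fset ed); exists x, y, (t - n%:R); split.
- by rewrite SubK.
- by rewrite -natr1 in n2; apply/andP; split; lra.
- apply: row_ord0P => i; rewrite !mxE; case: eqP => _; last by rewrite !mulr0 addr0.
  by rewrite -[n.+1%:~R]/(n.+1%:R) -[n%:~R]/(n%:R) -natr1; ring.
Qed.

(** A half-axis from the origin is connected, unbounded and covered by bonds. If [A] met no bond,
    the half-axis would lie in the bounded component of the origin. *)
Lemma inside_meets_bond A : (0 < d)%N -> inside A 0 -> exists e : edge d, bond e `&` A !=set0.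
Proof.
move=> d0 [U [[x nAx UE] bU] U0]; apply: contrapT => no.
pose k : 'I_d := Ordinal d0; pose f (t : R) : space := t *: lp (unit_step k 1).
pose L := f @` [set t | 0 <= t].
have LA : L `<=` ~` A.
  move=> _ [t t0 <-] At; have [e be] := axis_bond k t0.
  by apply: no; exists e, (f t).
have L0 : L 0 by exists 0; rewrite /= ?lexx // /f scale0r.
have conL : connected L.
  apply: connected_continuous_connected.
    apply/connected_intervalP => a b /= a0 b0 c /andP[ac _].
    exact: le_trans ac.
  apply: continuous_subspaceT; apply: continuous_row => i; under eq_fun do rewrite mxE.
  move=> t; apply: (@continuousM R R (fun t => t) (fun=> lp (unit_step k 1) ord0 i)).
    exact: cvg_id.
  exact: cvg_cst.
have LU : L `<=` U.
  move: U0; rewrite -UE => /same_connected_component ->.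
  exact: connected_component_max.
have [M hM] := (bounded_setP U).1 bU.
have fL : L (f (`|M| + 1)) by exists (`|M| + 1) => //=; rewrite addr_ge0.
have := hM _ (LU _ fL) k; rewrite !mxE eqxx mulr1 ger0_norm ?addr_ge0 //.
by have := ler_norm M; lra.
Qed.

(** Almost surely no edge is closed, whereas a sphere around the origin has to meet a bond. This
    makes the set defining the critical probability nonempty, so that its infimum is meaningful. *)
Lemma percolation_one_sphere_event : (0 < d)%N -> percolation d (1 : R) (@sphere_event R d) = 0%E.
Proof.
move=> d0; apply: measure_negligible; first exact: measurable_sphere_event.
pose closed_at (e : edge d) : set (config d) := [set w | w e = false].
have closed0 e : (percolation d (1 : R)).-negligible (closed_at e).
  have me : measurable (closed_at e).
    rewrite [X in measurable X](_ : _ = ~` [set w : config d | w e]).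
      by apply: measurableC; exact: measurable_open.
    by apply/seteqP; split=> w /= => [->|/negP/negbTE].
  apply/negligibleP => //.
  have p01 : 0 <= (1 : R) <= 1 by rewrite ler01 lexx.
  have := @percolationP R d 1 p01 [fset e]%fset (fun=> false).
  rewrite big_seq_fset1 subrr => e0; transitivity (0%:E : \bar R) => //.
  rewrite -e0; congr (percolation d _ _).
  by apply/seteqP; split=> w /= => [we e' /fset1P -> //|]; apply; rewrite inE.
pose G n : set (config d) := if choice.unpickle n is Some e then closed_at e else set0.
apply: (@negligibleS _ _ _ _ (\bigcup_n G n)); last first.
  apply: negligible_bigcup => n; rewrite /G; case: choice.unpickle => [e|].
    exact: closed0.
  exact: negligible_set0.
move=> w [A [_ cA iA]]; have [e eA] := inside_meets_bond d0 iA.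
by exists (choice.pickle e) => //; rewrite /G choice.pickleK; exact: cA.
Qed.

Lemma reach_finite_sphere_event (w : config d) : finite_set (reach w) -> sphere_event R w.
Proof. by move=> fin; exists (@random_sphere R d w); exact: random_sphere_closed. Qed.

(** The sphere event and [far n] together cover all configurations, and for some [n] the second has
    probability less than 1. *)
Lemma percolation_sphere_event_neq0 (p : R) : (3 <= d)%N -> 0 <= p <= 1 ->
  p < 1 / (8 * (d%:R - 1)) -> percolation d p (@sphere_event R d) != 0%E.
Proof.
move=> hd p01 pc; have d3 : 3 <= d%:R :> R by rewrite (ler_nat R 3).
pose c : R := 1 / (8 * (d%:R - 1)).
have c0 : 0 < c by rewrite divr_gt0 // mulr_gt0 //; lra.
(* The value [p = 0] is allowed here, whereas the walk weights need a positive parameter [q] that is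
   at least [p] and below the threshold. *)
pose q := Num.max p (c / 2).
have q0 : 0 < q by rewrite lt_max divr_gt0 ?orbT.
have pq : p <= q by rewrite le_max lexx.
have qc : q < c by rewrite gt_max pc /=; lra.
have [n hn] := far_eventually_small hd p01 q0 pq qc ltr01.
apply/eqP => e0; have : (1 <= percolation d p (far n))%E; last by rewrite leNgt hn.
rewrite -(probability_setT (percolation d p)) -[leRHS]add0e -e0.
apply: le_trans (measureU2 _ (measurable_sphere_event) (measurable_far n)).
apply: le_measure; rewrite ?inE //.
  by apply: measurableU; [exact: measurable_sphere_event|exact: measurable_far].
move=> w _; have [fin|inf] := pselect (finite_set (reach w)); [left|right].
  exact: reach_finite_sphere_event.
exact: far_infinite.
Qed.

End SphereEvent.

Unset Implicit Arguments.

Theorem theorem3 (R : realType) (d : nat) (hd : (3 <= d)%N) :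
  1 / (8 * (d%:R - 1)) <= p_c_sphere R d /\
  (forall p : R, 0 < p < 1 -> p < 1 / (8 * (d%:R - 1)) ->
   forall alpha : R, Num.sqrt (8 * p * (d%:R - 1)) < alpha < 1 ->
   exists (C : R) (S : config d -> set 'rV[R]_d),
     [/\ 0 < C,
         measurable_fun [set: config d] (fun w => l1_radius (S w)),
         \forall w \ae percolation d p, closed_sphere_around_origin w (S w) &
         forall r : R, 0 < r ->
           (percolation d p [set w | r%:E <= l1_radius (S w)] <= (C * alpha `^ r)%:E)%E]).
Proof.
have d0 : (0 < d)%N by exact: leq_trans hd.
split.
  apply: lb_le_inf; first by exists 1 => /=; rewrite ler01 lexx percolation_one_sphere_event.
  move=> p [p01 p0]; rewrite leNgt; apply/negP => pc.
  by have := percolation_sphere_event_neq0 hd p01 pc; rewrite p0 eqxx.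
move=> p /andP[p_gt0 p_lt1] pc alpha ha.
have p01 : 0 <= p <= 1 by rewrite !ltW.
(* Since [p] is positive, [q = p] is admissible, and [alpha0] is exactly the stated lower bound for
   [alpha]. *)
have [C C0 tail] := radius_tail hd p01 p_gt0 (lexx p) pc ha.
exists C, (@random_sphere R d); split => //; first exact: measurable_radius.
apply: filterS (reach_finite_ae hd p01 p_gt0 (lexx p) pc) => w.
exact: random_sphere_closed.
Qed.
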